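(* For every integer $n\ge 1$, the algebra $\mathcal{E}_n(x)$ is generically semisimple; that is, there is a nonempty Zariski open subset $U$ of $\mathbb{C}$, with $0\notin U$, such that the $\mathbb{C}$-algebra $\mathcal{E}_n(x)$ is semisimple for all $x\in U$.
   Context: Let $\mathcal{A}=\mathbb{C}[u,u^{-1}]$. $\mathcal{E}_n^{\mathcal{A}}(u)$ is the unital associative $\mathcal{A}$-algebra generated by $T_1,\dots,T_{n-1},E_1,\dots,E_{n-1}$ with defining relations (A1) $T_iT_j=T_jT_i$ if $|i-j|>1$; (A2) $E_iE_j=E_jE_i$ for all $i,j$; (A3) $E_i^2=E_i$; (A4) $E_iT_i=T_iE_i$; (A5) $E_iT_j=T_jE_i$ if $|i-j|>1$; (A6) $T_iT_jT_i=T_jT_iT_j$ if $|i-j|=1$; (A7) $E_jT_iT_j=T_iT_jE_i$ if $|i-j|=1$; (A8) $E_iE_jT_j=E_iT_jE_i=T_jE_iE_j$ if $|i-j|=1$; (A9) $T_i^2=1+(u-1)E_i(1-T_i)$. For a nonzero complex number $x$, $\mathcal{E}_n(x)=\mathcal{E}_n^{\mathcal{A}}(u)\otimes_{\mathcal{A}}\mathbb{C}$, where $\mathbb{C}$ is an $\mathcal{A}$-algebra via $u\mapsto x$. *)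

(* Defs.v *)
From HB Require Import structures.
From mathcomp Require Import all_boot all_order all_algebra.
From mathcomp Require Import boolp classical_sets reals.
From mathcomp Require Import complex.

Set Implicit Arguments.
Unset Strict Implicit.
Unset Printing Implicit Defensive.

Import GRing.Theory.
Local Open Scope ring_scope.
Local Open Scope quotient_scope.

Section Presentation.
Variables (K : comNzRingType) (G : Type).

(* Noncommutative polynomial expressions in the generators; [TCst k] stands
   for [k] times the unit. *)
Inductive aterm : Type :=
| TGen of G
| TCst of K
| TAdd of aterm & aterm
| TOpp of aterm
| TMul of aterm & aterm.

HB.instance Definition _ := gen_eqMixin aterm.
HB.instance Definition _ := gen_choiceMixin aterm.

Variable rels : aterm -> aterm -> Prop.

(* The smallest congruence that contains [rels] and makes the quotient a unital
   associative K-algebra. *)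
Inductive pres_eq : aterm -> aterm -> Prop :=
| pres_rel s t : rels s t -> pres_eq s t
| pres_refl s : pres_eq s s
| pres_sym s t : pres_eq s t -> pres_eq t s
| pres_trans s t r : pres_eq s t -> pres_eq t r -> pres_eq s r
| pres_congD s s' t t' :
    pres_eq s s' -> pres_eq t t' -> pres_eq (TAdd s t) (TAdd s' t')
| pres_congN s s' : pres_eq s s' -> pres_eq (TOpp s) (TOpp s')
| pres_congM s s' t t' :
    pres_eq s s' -> pres_eq t t' -> pres_eq (TMul s t) (TMul s' t')
| pres_addA s t r : pres_eq (TAdd s (TAdd t r)) (TAdd (TAdd s t) r)
| pres_addC s t : pres_eq (TAdd s t) (TAdd t s)
| pres_add0 s : pres_eq (TAdd (TCst 0) s) s
| pres_addN s : pres_eq (TAdd (TOpp s) s) (TCst 0)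
| pres_mulA s t r : pres_eq (TMul s (TMul t r)) (TMul (TMul s t) r)
| pres_1mul s : pres_eq (TMul (TCst 1) s) s
| pres_mul1 s : pres_eq (TMul s (TCst 1)) s
| pres_mulDl s t r :
    pres_eq (TMul (TAdd s t) r) (TAdd (TMul s r) (TMul t r))
| pres_mulDr s t r :
    pres_eq (TMul r (TAdd s t)) (TAdd (TMul r s) (TMul r t))
| pres_cstD a b : pres_eq (TCst (a + b)) (TAdd (TCst a) (TCst b))
| pres_cstM a b : pres_eq (TCst (a * b)) (TMul (TCst a) (TCst b))
| pres_cstC a s : pres_eq (TMul (TCst a) s) (TMul s (TCst a)).

Definition pres_eqb (s t : aterm) : bool := `[< pres_eq s t >].

Lemma pres_eqb_refl : reflexive pres_eqb.
Proof. by move=> s; apply/asboolP/pres_refl. Qed.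

Lemma pres_eqb_sym : symmetric pres_eqb.
Proof. by move=> s t; apply/asboolP/asboolP; apply: pres_sym. Qed.

Lemma pres_eqb_trans : transitive pres_eqb.
Proof.
by move=> s t r /asboolP st /asboolP tr; apply/asboolP/(pres_trans st tr).
Qed.

Canonical pres_equiv :=
  EquivRel pres_eqb pres_eqb_refl pres_eqb_sym pres_eqb_trans.

Definition pres_alg : Type := {eq_quot pres_equiv}.

HB.instance Definition _ := Choice.on pres_alg.
HB.instance Definition _ := EqQuotient.on pres_alg.

Definition pres_pi (s : aterm) : pres_alg := \pi_pres_alg s.

Lemma pres_piP s t : pres_pi s = pres_pi t <-> pres_eq s t.
Proof.
by split=> [/eqmodP/asboolP|h]; [|apply/eqmodP/asboolP].
Qed.

Lemma pres_reprK x : pres_pi (repr x) = x.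
Proof. exact: reprK. Qed.

Lemma pres_repr_pi s : pres_eq (repr (pres_pi s)) s.
Proof. by apply/pres_piP; rewrite pres_reprK. Qed.

Lemma pres_ind (P : pres_alg -> Prop) :
  (forall s, P (pres_pi s)) -> forall x, P x.
Proof. by move=> h x; rewrite -(pres_reprK x). Qed.

Definition pres_add (x y : pres_alg) := pres_pi (TAdd (repr x) (repr y)).
Definition pres_opp (x : pres_alg) := pres_pi (TOpp (repr x)).
Definition pres_mul (x y : pres_alg) := pres_pi (TMul (repr x) (repr y)).
Definition pres_scale (k : K) (x : pres_alg) :=
  pres_pi (TMul (TCst k) (repr x)).

Lemma pres_addE s t : pres_add (pres_pi s) (pres_pi t) = pres_pi (TAdd s t).
Proof. by apply/pres_piP/pres_congD; apply: pres_repr_pi. Qed.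

Lemma pres_oppE s : pres_opp (pres_pi s) = pres_pi (TOpp s).
Proof. by apply/pres_piP/pres_congN; apply: pres_repr_pi. Qed.

Lemma pres_mulE s t : pres_mul (pres_pi s) (pres_pi t) = pres_pi (TMul s t).
Proof. by apply/pres_piP/pres_congM; apply: pres_repr_pi. Qed.

Lemma pres_scaleE k s : pres_scale k (pres_pi s) = pres_pi (TMul (TCst k) s).
Proof. by apply/pres_piP/pres_congM; [exact: pres_refl|exact: pres_repr_pi]. Qed.

Let presE := (pres_addE, pres_oppE, pres_mulE, pres_scaleE).

Fact pres_addrA : associative pres_add.
Proof.
by elim/pres_ind=> s; elim/pres_ind=> t; elim/pres_ind=> r; rewrite !presE;
  apply/pres_piP/pres_addA.
Qed.
Fact pres_addrC : commutative pres_add.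
Proof.
by elim/pres_ind=> s; elim/pres_ind=> t; rewrite !presE;
  apply/pres_piP/pres_addC.
Qed.
Fact pres_add0r : left_id (pres_pi (TCst 0)) pres_add.
Proof. by elim/pres_ind=> s; rewrite !presE; apply/pres_piP/pres_add0. Qed.
Fact pres_addNr : left_inverse (pres_pi (TCst 0)) pres_opp pres_add.
Proof. by elim/pres_ind=> s; rewrite !presE; apply/pres_piP/pres_addN. Qed.
Fact pres_mulrA : associative pres_mul.
Proof.
by elim/pres_ind=> s; elim/pres_ind=> t; elim/pres_ind=> r; rewrite !presE;
  apply/pres_piP/pres_mulA.
Qed.
Fact pres_mul1r : left_id (pres_pi (TCst 1)) pres_mul.
Proof. by elim/pres_ind=> s; rewrite !presE; apply/pres_piP/pres_1mul. Qed.
Fact pres_mulr1 : right_id (pres_pi (TCst 1)) pres_mul.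
Proof. by elim/pres_ind=> s; rewrite !presE; apply/pres_piP/pres_mul1. Qed.
Fact pres_mulrDl : left_distributive pres_mul pres_add.
Proof.
by elim/pres_ind=> s; elim/pres_ind=> t; elim/pres_ind=> r; rewrite !presE;
  apply/pres_piP/pres_mulDl.
Qed.
Fact pres_mulrDr : right_distributive pres_mul pres_add.
Proof.
by elim/pres_ind=> s; elim/pres_ind=> t; elim/pres_ind=> r; rewrite !presE;
  apply/pres_piP/pres_mulDr.
Qed.

HB.instance Definition _ := GRing.isPzRing.Build pres_alg
  pres_addrA pres_addrC pres_add0r pres_addNr
  pres_mulrA pres_mul1r pres_mulr1 pres_mulrDl pres_mulrDr.

Lemma pres_piD s t : pres_pi (TAdd s t) = pres_pi s + pres_pi t.
Proof. by rewrite -pres_addE. Qed.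
Lemma pres_piN s : pres_pi (TOpp s) = - pres_pi s.
Proof. by rewrite -pres_oppE. Qed.
Lemma pres_piM s t : pres_pi (TMul s t) = pres_pi s * pres_pi t.
Proof. by rewrite -pres_mulE. Qed.
Lemma pres_pi0 : pres_pi (TCst 0) = 0. Proof. by []. Qed.
Lemma pres_pi1 : pres_pi (TCst 1) = 1. Proof. by []. Qed.

Lemma pres_scaleM k x : pres_scale k x = pres_pi (TCst k) * x.
Proof. by elim/pres_ind: x => s; rewrite presE pres_piM. Qed.

Lemma pres_cstMC k x : pres_pi (TCst k) * x = x * pres_pi (TCst k).
Proof.
by elim/pres_ind: x => s; rewrite -!pres_piM; apply/pres_piP/pres_cstC.
Qed.

Fact pres_scalerA a b v : pres_scale a (pres_scale b v) = pres_scale (a * b) v.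
Proof.
by rewrite !pres_scaleM mulrA -pres_piM; congr (_ * _); apply/pres_piP/pres_sym/pres_cstM.
Qed.
Fact pres_scale1r : left_id 1 pres_scale.
Proof. by move=> x; rewrite pres_scaleM pres_pi1 mul1r. Qed.
Fact pres_scalerDr : right_distributive pres_scale +%R.
Proof. by move=> a x y; rewrite !pres_scaleM mulrDr. Qed.
Fact pres_scalerDl v : {morph pres_scale^~ v : a b / a + b >-> a + b}.
Proof.
move=> a b /=; rewrite !pres_scaleM -mulrDl -pres_piD; congr (_ * _).
exact/pres_piP/pres_cstD.
Qed.

HB.instance Definition _ := GRing.Zmodule_isLmodule.Build K pres_alg
  pres_scalerA pres_scale1r pres_scalerDr pres_scalerDl.

Fact pres_scalerAl (k : K) (x y : pres_alg) : k *: (x * y) = (k *: x) * y.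
Proof. by rewrite /GRing.scale /= !pres_scaleM mulrA. Qed.
Fact pres_scalerAr (k : K) (x y : pres_alg) : k *: (x * y) = x * (k *: y).
Proof. by rewrite /GRing.scale /= !pres_scaleM !mulrA pres_cstMC. Qed.

Fixpoint aterm_eval (B : algType K) (v : G -> B) (s : aterm) : B :=
  match s with
  | TGen g => v g
  | TCst k => k%:A
  | TAdd s t => aterm_eval v s + aterm_eval v t
  | TOpp s => - aterm_eval v s
  | TMul s t => aterm_eval v s * aterm_eval v t
  end.

Lemma pres_eq_eval (B : algType K) (v : G -> B) :
  (forall s t, rels s t -> aterm_eval v s = aterm_eval v t) ->
  forall s t, pres_eq s t -> aterm_eval v s = aterm_eval v t.
Proof.
move=> h s t; elim=> {s t} //=.
- by move=> s t r _ -> _ ->.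
- by move=> s s' t t' _ -> _ ->.
- by move=> s s' _ ->.
- by move=> s s' t t' _ -> _ ->.
- by move=> *; rewrite addrA.
- by move=> *; rewrite addrC.
- by move=> *; rewrite scale0r add0r.
- by move=> *; rewrite scale0r addNr.
- by move=> *; rewrite mulrA.
- by move=> *; rewrite scale1r mul1r.
- by move=> *; rewrite scale1r mulr1.
- by move=> *; rewrite mulrDl.
- by move=> *; rewrite mulrDr.
- by move=> *; rewrite scalerDl.
- by move=> *; rewrite mulr_algl scalerA.
- by move=> *; rewrite mulr_algl mulr_algr.
Qed.

End Presentation.

Arguments TGen {K G}.
Arguments TCst {K G}.

Section Tensor.
Variables (A : comNzRingType) (E : algType A).
Variables (B : comNzRingType) (f : {rmorphism A -> B}).

(* [:: (e1, b1); ...; (ek, bk)] encodes e1 (x) b1 + ... + ek (x) bk. *)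
Definition tsum : Type := seq (E * B).

HB.instance Definition _ := gen_eqMixin tsum.
HB.instance Definition _ := gen_choiceMixin tsum.

(* Without [tens_0l] the quotient would only be a monoid: biadditivity does not
   identify 0 (x) b with the empty sum. *)
Inductive tens_eq : tsum -> tsum -> Prop :=
| tens_refl s : tens_eq s s
| tens_sym s t : tens_eq s t -> tens_eq t s
| tens_trans s t r : tens_eq s t -> tens_eq t r -> tens_eq s r
| tens_cong s s' t t' :
    tens_eq s s' -> tens_eq t t' -> tens_eq (s ++ t) (s' ++ t')
| tens_addC s t : tens_eq (s ++ t) (t ++ s)
| tens_0l b : tens_eq [:: (0, b)] [::]
| tens_Dl e e' b : tens_eq [:: (e + e', b)] [:: (e, b); (e', b)]
| tens_Dr e b b' : tens_eq [:: (e, b + b')] [:: (e, b); (e, b')]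
| tens_bal a e b : tens_eq [:: (a *: e, b)] [:: (e, f a * b)].

Definition tens_eqb (s t : tsum) : bool := `[< tens_eq s t >].

Lemma tens_eqb_refl : reflexive tens_eqb.
Proof. by move=> s; apply/asboolP/tens_refl. Qed.

Lemma tens_eqb_sym : symmetric tens_eqb.
Proof. by move=> s t; apply/asboolP/asboolP; apply: tens_sym. Qed.

Lemma tens_eqb_trans : transitive tens_eqb.
Proof.
by move=> s t r /asboolP st /asboolP tr; apply/asboolP/(tens_trans st tr).
Qed.

Canonical tens_equiv :=
  EquivRel tens_eqb tens_eqb_refl tens_eqb_sym tens_eqb_trans.

Definition tensor : Type := {eq_quot tens_equiv}.

HB.instance Definition _ := Choice.on tensor.
HB.instance Definition _ := EqQuotient.on tensor.

Definition tens_pi (s : tsum) : tensor := \pi_tensor s.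

Lemma tens_piP s t : tens_pi s = tens_pi t <-> tens_eq s t.
Proof. by split=> [/eqmodP/asboolP|h]; [|apply/eqmodP/asboolP]. Qed.

Lemma tens_reprK x : tens_pi (repr x) = x.
Proof. exact: reprK. Qed.

Lemma tens_repr_pi s : tens_eq (repr (tens_pi s)) s.
Proof. by apply/tens_piP; rewrite tens_reprK. Qed.

Lemma tens_ind (P : tensor -> Prop) :
  (forall s, P (tens_pi s)) -> forall x, P x.
Proof. by move=> h x; rewrite -(tens_reprK x). Qed.

Definition tsum_opp (s : tsum) : tsum := [seq (- p.1, p.2) | p <- s].
Definition tsum_scale (b : B) (s : tsum) : tsum :=
  [seq (p.1, b * p.2) | p <- s].
Definition tsum_mul (s t : tsum) : tsum :=
  [seq (p.1 * q.1, p.2 * q.2) | p <- s, q <- t].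

Definition tens_add (x y : tensor) := tens_pi (repr x ++ repr y).
Definition tens_opp (x : tensor) := tens_pi (tsum_opp (repr x)).
Definition tens_scale (b : B) (x : tensor) := tens_pi (tsum_scale b (repr x)).
Definition tens_mul (x y : tensor) := tens_pi (tsum_mul (repr x) (repr y)).

Lemma tens_map (g : E * B -> E * B) s t :
    (forall b, tens_eq [:: g (0, b)] [::]) ->
    (forall e e' b, tens_eq [:: g (e + e', b)] [:: g (e, b); g (e', b)]) ->
    (forall e b b', tens_eq [:: g (e, b + b')] [:: g (e, b); g (e, b')]) ->
    (forall a e b, tens_eq [:: g (a *: e, b)] [:: g (e, f a * b)]) ->
  tens_eq s t -> tens_eq (map g s) (map g t).
Proof.
move=> h0 hl hr hb; elim=> {s t} /=.
- by move=> s; apply: tens_refl.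
- by move=> s t _; apply: tens_sym.
- by move=> s t r _ h _; apply: tens_trans.
- by move=> s s' t t' _ h _ h'; rewrite !map_cat; apply: tens_cong.
- by move=> s t; rewrite !map_cat; apply: tens_addC.
- exact: h0.
- exact: hl.
- exact: hr.
- exact: hb.
Qed.

Lemma tens_0r e : tens_eq [:: (e, 0)] [::].
Proof.
apply: (tens_trans _ (tens_0l 0)); apply: tens_sym.
by rewrite -(scale0r e) -[X in tens_eq _ [:: (_, X)]](mul0r (0 : B)) -(rmorph0 f);
  apply: tens_bal.
Qed.

Lemma tsum_opp_eq s t : tens_eq s t -> tens_eq (tsum_opp s) (tsum_opp t).
Proof.
apply: tens_map => /= [b|e e' b|e b b'|a e b].
- by rewrite oppr0; apply: tens_0l.
- by rewrite opprD; apply: tens_Dl.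
- exact: tens_Dr.
- by rewrite -scalerN; apply: tens_bal.
Qed.

Lemma tsum_scale_eq c s t :
  tens_eq s t -> tens_eq (tsum_scale c s) (tsum_scale c t).
Proof.
apply: tens_map => /= [b|e e' b|e b b'|a e b].
- exact: tens_0l.
- exact: tens_Dl.
- by rewrite mulrDr; apply: tens_Dr.
- by rewrite mulrCA; apply: tens_bal.
Qed.

Lemma tsum_mul1l p t : tsum_mul [:: p] t = [seq (p.1 * q.1, p.2 * q.2) | q <- t].
Proof. by rewrite /tsum_mul /= cats0. Qed.

Lemma tsum_mul_cons p s t : tsum_mul (p :: s) t = tsum_mul [:: p] t ++ tsum_mul s t.
Proof. by rewrite tsum_mul1l. Qed.

Lemma tsum_mul1_cat p t t' :
  tsum_mul [:: p] (t ++ t') = tsum_mul [:: p] t ++ tsum_mul [:: p] t'.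
Proof. by rewrite !tsum_mul1l map_cat. Qed.

Lemma tsum_mul_catl s s' t :
  tsum_mul (s ++ s') t = tsum_mul s t ++ tsum_mul s' t.
Proof. exact: allpairs_cat. Qed.

Lemma tens_congl s s' t : tens_eq s s' -> tens_eq (s ++ t) (s' ++ t).
Proof. by move=> h; apply: tens_cong h (tens_refl _). Qed.

Lemma tens_congr s t t' : tens_eq t t' -> tens_eq (s ++ t) (s ++ t').
Proof. by move=> h; apply: tens_cong (tens_refl _) h. Qed.

Lemma tens_ACA s t s' t' : tens_eq ((s ++ t) ++ (s' ++ t')) ((s ++ s') ++ (t ++ t')).
Proof.
rewrite -!catA; apply: tens_congr; rewrite !catA; apply: tens_congl.
exact: tens_addC.
Qed.

Lemma tsum_mul_catr s t t' :
  tens_eq (tsum_mul s (t ++ t')) (tsum_mul s t ++ tsum_mul s t').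
Proof.
elim: s => [|p s IHs]; first exact: tens_refl.
rewrite tsum_mul_cons (tsum_mul_cons p s t) (tsum_mul_cons p s t').
rewrite !tsum_mul1l map_cat.
apply: tens_trans (tens_congr _ IHs) _; exact: tens_ACA.
Qed.

Lemma tsum_mul_eqr s t t' :
  tens_eq t t' -> tens_eq (tsum_mul s t) (tsum_mul s t').
Proof.
move=> tt'; elim: s => [|p s IHs]; first exact: tens_refl.
rewrite tsum_mul_cons (tsum_mul_cons p s t'); apply: tens_cong IHs.
rewrite !tsum_mul1l; apply: tens_map tt' => /= [b|e e' b|e b b'|a e b].
- by rewrite mulr0; apply: tens_0l.
- by rewrite mulrDr; apply: tens_Dl.
- by rewrite mulrDr; apply: tens_Dr.
- by rewrite -scalerAr mulrCA; apply: tens_bal.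
Qed.

Lemma tsum_mulr1 s q : tsum_mul s [:: q] = [seq (p.1 * q.1, p.2 * q.2) | p <- s].
Proof. by elim: s => // p s IHs; rewrite tsum_mul_cons IHs. Qed.

Lemma tsum_mulr0 s : tsum_mul s [::] = [::].
Proof. by elim: s => // p s IHs; rewrite tsum_mul_cons IHs. Qed.

Lemma tsum_mul_eql s s' t :
  tens_eq s s' -> tens_eq (tsum_mul s t) (tsum_mul s' t).
Proof.
move=> ss'; elim: t => [|q t IHt].
  by rewrite !tsum_mulr0; apply: tens_refl.
rewrite -cat1s; apply: (tens_trans (tsum_mul_catr _ _ _)).
apply: tens_trans (tens_sym (tsum_mul_catr _ _ _)); apply: tens_cong IHt.
rewrite !tsum_mulr1; apply: tens_map ss' => /= [b|e e' b|e b b'|a e b].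
- by rewrite mul0r; apply: tens_0l.
- by rewrite mulrDl; apply: tens_Dl.
- by rewrite mulrDl; apply: tens_Dr.
- by rewrite -scalerAl -mulrA; apply: tens_bal.
Qed.

Lemma tens_addE s t : tens_add (tens_pi s) (tens_pi t) = tens_pi (s ++ t).
Proof. by apply/tens_piP/tens_cong; apply: tens_repr_pi. Qed.

Lemma tens_oppE s : tens_opp (tens_pi s) = tens_pi (tsum_opp s).
Proof. by apply/tens_piP/tsum_opp_eq; apply: tens_repr_pi. Qed.

Lemma tens_scaleE b s : tens_scale b (tens_pi s) = tens_pi (tsum_scale b s).
Proof. by apply/tens_piP/tsum_scale_eq; apply: tens_repr_pi. Qed.

Lemma tens_mulE s t : tens_mul (tens_pi s) (tens_pi t) = tens_pi (tsum_mul s t).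
Proof.
apply/tens_piP; apply: (tens_trans (tsum_mul_eql _ (tens_repr_pi s))).
exact: tsum_mul_eqr (tens_repr_pi t).
Qed.

Let tensE := (tens_addE, tens_oppE, tens_scaleE, tens_mulE).

Fact tens_addrA : associative tens_add.
Proof.
by elim/tens_ind=> s; elim/tens_ind=> t; elim/tens_ind=> r; rewrite !tensE catA.
Qed.
Fact tens_addrC : commutative tens_add.
Proof.
by elim/tens_ind=> s; elim/tens_ind=> t; rewrite !tensE;
  apply/tens_piP/tens_addC.
Qed.
Fact tens_add0r : left_id (tens_pi [::]) tens_add.
Proof. by elim/tens_ind=> s; rewrite !tensE. Qed.
Fact tens_addNr : left_inverse (tens_pi [::]) tens_opp tens_add.
Proof.
elim/tens_ind=> s; rewrite !tensE; apply/tens_piP.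
elim: s => [|[e b] s IHs]; first exact: tens_refl.
rewrite -cat1s /tsum_opp map_cat; apply: (tens_trans (tens_ACA _ _ _ _)).
rewrite -[X in tens_eq _ X]cat0s; apply: tens_cong IHs => /=.
apply: (tens_trans (tens_sym (tens_Dl _ _ _))).
by rewrite addNr; apply: tens_0l.
Qed.
Fact tens_mulrA : associative tens_mul.
Proof.
elim/tens_ind=> s; elim/tens_ind=> t; elim/tens_ind=> r; rewrite !tensE.
congr tens_pi; elim: s => // p s IHs.
rewrite tsum_mul_cons (tsum_mul_cons p s t) tsum_mul_catl IHs; congr (_ ++ _).
elim: t {IHs} => // q t IHt.
rewrite (tsum_mul_cons q t r) tsum_mul1_cat IHt -(cat1s q t) tsum_mul1_cat.
rewrite tsum_mul_catl; congr (_ ++ _).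
rewrite [tsum_mul [:: p] [:: q]]tsum_mul1l [map _ _]/= !tsum_mul1l.
by rewrite -map_comp; apply: eq_map => x /=; rewrite !mulrA.
Qed.
Fact tens_mul1r : left_id (tens_pi [:: (1, 1)]) tens_mul.
Proof.
elim/tens_ind=> s; rewrite !tensE tsum_mul1l; congr tens_pi.
by rewrite -[RHS]map_id; apply: eq_map => -[e b] /=; rewrite !mul1r.
Qed.
Fact tens_mulr1 : right_id (tens_pi [:: (1, 1)]) tens_mul.
Proof.
elim/tens_ind=> s; rewrite !tensE tsum_mulr1; congr tens_pi.
by rewrite -[RHS]map_id; apply: eq_map => -[e b] /=; rewrite !mulr1.
Qed.
Fact tens_mulrDl : left_distributive tens_mul tens_add.
Proof.
elim/tens_ind=> s; elim/tens_ind=> t; elim/tens_ind=> r; rewrite !tensE.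
by rewrite tsum_mul_catl.
Qed.
Fact tens_mulrDr : right_distributive tens_mul tens_add.
Proof.
elim/tens_ind=> s; elim/tens_ind=> t; elim/tens_ind=> r; rewrite !tensE.
exact/tens_piP/tsum_mul_catr.
Qed.

HB.instance Definition _ := GRing.isPzRing.Build tensor
  tens_addrA tens_addrC tens_add0r tens_addNr
  tens_mulrA tens_mul1r tens_mulr1 tens_mulrDl tens_mulrDr.

Definition tens (e : E) (b : B) : tensor := tens_pi [:: (e, b)].

Lemma tens_piD s t : tens_pi (s ++ t) = tens_pi s + tens_pi t.
Proof. by rewrite -tens_addE. Qed.

Fact tens_scalerA a b v : tens_scale a (tens_scale b v) = tens_scale (a * b) v.
Proof.
elim/tens_ind: v => s; rewrite !tensE /tsum_scale -map_comp.
by congr tens_pi; apply: eq_map => p /=; rewrite mulrA.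
Qed.
Fact tens_scale1r : left_id 1 tens_scale.
Proof.
elim/tens_ind=> s; rewrite !tensE; congr tens_pi.
by rewrite -[RHS]map_id; apply: eq_map => -[e b] /=; rewrite mul1r.
Qed.
Fact tens_scalerDr : right_distributive tens_scale +%R.
Proof.
move=> a; elim/tens_ind=> s; elim/tens_ind=> t.
by rewrite -tens_piD !tensE -tens_piD /tsum_scale map_cat.
Qed.
Fact tens_scalerDl v : {morph tens_scale^~ v : a b / a + b >-> a + b}.
Proof.
elim/tens_ind: v => s a b; rewrite !tensE -tens_piD; apply/tens_piP.
elim: s => [|[e c] s IHs]; first exact: tens_refl.
rewrite -cat1s /tsum_scale !map_cat.
apply: tens_trans (tens_ACA _ _ _ _); apply: tens_cong IHs => /=.
by rewrite mulrDl; apply: tens_Dr.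
Qed.

HB.instance Definition _ := GRing.Zmodule_isLmodule.Build B tensor
  tens_scalerA tens_scale1r tens_scalerDr tens_scalerDl.

Fact tens_scalerAl (k : B) (x y : tensor) : k *: (x * y) = (k *: x) * y.
Proof.
elim/tens_ind: x => s; elim/tens_ind: y => t.
rewrite /GRing.scale /GRing.mul /= !tensE; congr tens_pi.
elim: s => // p s IHs; rewrite /= tsum_mul_cons (tsum_mul_cons (_, _)).
rewrite -IHs /tsum_scale map_cat; congr (_ ++ _).
by rewrite !tsum_mul1l -map_comp; apply: eq_map => q /=; rewrite mulrA.
Qed.
Fact tens_scalerAr (k : B) (x y : tensor) : k *: (x * y) = x * (k *: y).
Proof.
elim/tens_ind: x => s; elim/tens_ind: y => t.
rewrite /GRing.scale /GRing.mul /= !tensE; congr tens_pi.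
elim: s => // p s IHs; rewrite tsum_mul_cons (tsum_mul_cons p s).
rewrite -IHs /tsum_scale map_cat; congr (_ ++ _).
by rewrite !tsum_mul1l -!map_comp; apply: eq_map => q /=; rewrite mulrCA.
Qed.

Lemma tens_eq_sum (V : zmodType) (g : E -> B -> V) :
    (forall e e' b, g (e + e') b = g e b + g e' b) ->
    (forall e b b', g e (b + b') = g e b + g e b') ->
    (forall a e b, g (a *: e) b = g e (f a * b)) ->
  forall s t, tens_eq s t ->
  \sum_(p <- s) g p.1 p.2 = \sum_(p <- t) g p.1 p.2.
Proof.
move=> hl hr hb s t; elim=> {s t} //=.
- by move=> s t r _ -> _ ->.
- by move=> s s' t t' _ h _ h'; rewrite !big_cat /= h h'.
- by move=> s t; rewrite !big_cat /= addrC.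
- move=> b; rewrite big_seq1 big_nil /=.
  by apply: (addrI (g 0 b)); rewrite -hl !addr0.
- by move=> e e' b; rewrite !big_cons !big_nil !addr0 hl.
- by move=> e b b'; rewrite !big_cons !big_nil !addr0 hr.
- by move=> a e b; rewrite !big_seq1 hb.
Qed.

End Tensor.

Section Laurent.
Variable F : fieldType.

(* F[u, u^-1], realised inside F(u) as the elements p / u ^+ k. *)
Definition is_laurent : {pred {fraction {poly F}}} :=
  fun z => `[< exists (k : nat) (p : {poly F}),
    z * FracField.tofrac 'X ^+ k = FracField.tofrac p >].

Record laurent := Laurent {
  laurent_val : {fraction {poly F}};
  laurent_valP : laurent_val \in is_laurent }.

HB.instance Definition _ := [isSub for laurent_val].
HB.instance Definition _ := [Choice of laurent by <:].

Lemma laurent_subring : subring_closed is_laurent.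
Proof.
split.
- by apply/asboolP; exists 0%N, 1; rewrite expr0 mulr1 tofrac1.
- move=> y z /asboolP[k [p hp]] /asboolP[l [q hq]]; apply/asboolP.
  exists (k + l)%N, (p * 'X^l - q * 'X^k).
  rewrite exprD tofracB !tofracM !tofracXn -hp -hq mulrBl !mulrA.
  by rewrite (mulrAC z (_ ^+ l)).
- move=> y z /asboolP[k [p hp]] /asboolP[l [q hq]]; apply/asboolP.
  exists (k + l)%N, (p * q).
  by rewrite exprD tofracM -hp -hq mulrACA.
Qed.

HB.instance Definition _ :=
  GRing.SubChoice_isSubComNzRing.Build _ _ laurent laurent_subring.

Lemma laurent_polyP (p : {poly F}) : FracField.tofrac p \in is_laurent.
Proof. by apply/asboolP; exists 0%N, p; rewrite expr0 mulr1. Qed.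

Definition laurent_poly (p : {poly F}) : laurent := Laurent (laurent_polyP p).

Definition laurent_u : laurent := laurent_poly 'X.

Lemma laurent_repP (z : laurent) : exists kp : nat * {poly F},
  val z * FracField.tofrac 'X ^+ kp.1 = FracField.tofrac kp.2.
Proof. by have /asboolP[k [p h]] := laurent_valP z; exists (k, p). Qed.

Section Eval.
Variables (x : F) (x0 : x != 0).

(* u |-> x; the value does not depend on the chosen k and p because x != 0. *)
Definition laurent_eval of x != 0 := fun z : laurent =>
  let kp := sval (cid (laurent_repP z)) in kp.2.[x] / x ^+ kp.1.

Local Notation ev := (laurent_eval x0).

Lemma laurent_evalE (z : laurent) k (p : {poly F}) :
  val z * FracField.tofrac 'X ^+ k = FracField.tofrac p ->
  ev z = p.[x] / x ^+ k.
Proof.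
rewrite /laurent_eval; case: cid => -[l q] /= hq hp.
have /eqP : FracField.tofrac (q * 'X^k) = FracField.tofrac (p * 'X^l).
  by rewrite !tofracM !tofracXn -hq -hp mulrAC.
rewrite tofrac_eq => /eqP /(congr1 (horner^~ x)); rewrite !hornerE => h.
by apply/eqP; rewrite eqr_div ?expf_neq0 //; apply/eqP.
Qed.

Lemma laurent_eval_poly p : ev (laurent_poly p) = p.[x].
Proof. by rewrite (@laurent_evalE _ 0 p) ?expr0 ?mulr1 ?divr1. Qed.

Fact laurent_eval_zmod : zmod_morphism ev.
Proof.
move=> y z; have [[k p] /= hp] := laurent_repP y.
have [[l q] /= hq] := laurent_repP z.
rewrite (@laurent_evalE _ (k + l) (p * 'X^l - q * 'X^k)); last first.
  rewrite rmorphB exprD tofracB !tofracM !tofracXn -hp -hq mulrBl !mulrA.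
  by rewrite (mulrAC (val z) (_ ^+ l)).
rewrite (laurent_evalE hp) (laurent_evalE hq) !hornerE exprD mulrBl.
congr (_ - _); first by rewrite -mulf_div divff ?expf_neq0 // mulr1.
by rewrite [x ^+ k * _]mulrC -mulf_div divff ?expf_neq0 // mulr1.
Qed.

Fact laurent_eval_monoid : monoid_morphism ev.
Proof.
split=> [|y z].
  rewrite (@laurent_evalE _ 0 1); first by rewrite expr0 hornerC divr1.
  by rewrite expr0 tofrac1 mulr1.
have [[k p] /= hp] := laurent_repP y; have [[l q] /= hq] := laurent_repP z.
rewrite (@laurent_evalE _ (k + l) (p * q)); last first.
  by rewrite rmorphM exprD tofracM -hp -hq mulrACA.
by rewrite (laurent_evalE hp) (laurent_evalE hq) hornerM exprD mulf_div.
Qed.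

HB.instance Definition _ :=
  GRing.isZmodMorphism.Build laurent F (laurent_eval x0) laurent_eval_zmod.
HB.instance Definition _ :=
  GRing.isMonoidMorphism.Build laurent F (laurent_eval x0) laurent_eval_monoid.

End Eval.
End Laurent.

Section BraidsTies.
Variables (F : fieldType) (n : nat).

(* The index i : 'I_n.-1 stands for i + 1 in {1, ..., n - 1}. *)
Inductive bt_gen : Type := GT of 'I_n.-1 | GE of 'I_n.-1.

Local Notation A := (laurent F).
Local Notation T i := (TGen (GT i) : aterm A bt_gen).
Local Notation E i := (TGen (GE i) : aterm A bt_gen).
Declare Scope aterm_scope.
Delimit Scope aterm_scope with AT.
Local Infix "+" := TAdd : aterm_scope.
Local Infix "*" := TMul : aterm_scope.
Local Notation "s - t" := (TAdd s (TOpp t)) : aterm_scope.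
Local Notation "1" := (TCst 1%R) : aterm_scope.
Local Notation "c %:K" := (TCst c%R) (at level 2) : aterm_scope.
Local Notation u := (laurent_u F).
Local Notation dist i j := `|i%:Z - j%:Z|%N.

Inductive bt_rel : aterm A bt_gen -> aterm A bt_gen -> Prop :=
| bt_A1 (i j : 'I_n.-1) : (dist i j > 1)%N ->
    bt_rel (T i * T j)%AT (T j * T i)%AT
| bt_A2 (i j : 'I_n.-1) : bt_rel (E i * E j)%AT (E j * E i)%AT
| bt_A3 (i : 'I_n.-1) : bt_rel (E i * E i)%AT (E i)
| bt_A4 (i : 'I_n.-1) : bt_rel (E i * T i)%AT (T i * E i)%AT
| bt_A5 (i j : 'I_n.-1) : (dist i j > 1)%N ->
    bt_rel (E i * T j)%AT (T j * E i)%AT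
| bt_A6 (i j : 'I_n.-1) : dist i j = 1%N ->
    bt_rel (T i * T j * T i)%AT (T j * T i * T j)%AT
| bt_A7 (i j : 'I_n.-1) : dist i j = 1%N ->
    bt_rel (E j * T i * T j)%AT (T i * T j * E i)%AT
| bt_A8l (i j : 'I_n.-1) : dist i j = 1%N ->
    bt_rel (E i * E j * T j)%AT (E i * T j * E i)%AT
| bt_A8r (i j : 'I_n.-1) : dist i j = 1%N ->
    bt_rel (E i * T j * E i)%AT (T j * E i * E j)%AT
| bt_A9 (i : 'I_n.-1) :
    bt_rel (T i * T i)%AT (1 + (u - 1)%:K * E i * (1 - T i))%AT.

Definition bt_alg : Type := pres_alg bt_rel.

HB.instance Definition _ := GRing.PzRing.on bt_alg.
HB.instance Definition _ := GRing.Lmodule.on bt_alg.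

(* All generators may be sent to 1, so the algebra is nonzero. *)
Definition bt_aug_term (s : aterm A bt_gen) : A :=
  aterm_eval (B := A^o) (fun=> 1) s.

Lemma bt_aug_eq s t : pres_eq bt_rel s t -> bt_aug_term s = bt_aug_term t.
Proof.
rewrite /bt_aug_term; apply: (@pres_eq_eval _ _ bt_rel A^o) => {s t} s t.
by case=> //= *; rewrite ?scale1r ?subrr ?mulr0 ?addr0 ?mulr1.
Qed.

Definition bt_aug (x : bt_alg) : A := bt_aug_term (repr x).

Lemma bt_aug_pi s : bt_aug (pres_pi bt_rel s) = bt_aug_term s.
Proof. exact/bt_aug_eq/pres_repr_pi. Qed.

Lemma bt_aug1 : bt_aug 1 = 1.
Proof. by rewrite bt_aug_pi /bt_aug_term /= scale1r. Qed.

Lemma bt_augD x y : bt_aug (x + y) = bt_aug x + bt_aug y.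
Proof.
by elim/pres_ind: x => s; elim/pres_ind: y => t; rewrite -pres_piD !bt_aug_pi.
Qed.

Lemma bt_augZ a x : bt_aug (a *: x) = a * bt_aug x.
Proof.
elim/pres_ind: x => s; rewrite /GRing.scale /= pres_scaleE !bt_aug_pi.
by rewrite /bt_aug_term /= mulr_algl.
Qed.

Fact bt_oner_neq0 : (1 : bt_alg) != 0.
Proof.
apply/eqP => /(congr1 bt_aug); rewrite bt_aug1 -[0](scale0r (1 : bt_alg)).
by rewrite bt_augZ mul0r; apply/eqP/oner_neq0.
Qed.

HB.instance Definition _ := GRing.PzSemiRing_isNonZero.Build bt_alg bt_oner_neq0.
HB.instance Definition _ :=
  GRing.Lmodule_isLalgebra.Build A bt_alg (@pres_scalerAl _ _ bt_rel).
HB.instance Definition _ :=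
  GRing.Lalgebra_isAlgebra.Build A bt_alg (@pres_scalerAr _ _ bt_rel).

(* bt_alg (x)_A F, where A acts on F through u |-> x. *)
Definition bt_spec (x : F) (x0 : x != 0) : Type :=
  tensor bt_alg (laurent_eval x0).

Section Spec.
Variables (x : F) (x0 : x != 0).

HB.instance Definition _ := GRing.PzRing.on (bt_spec x0).
HB.instance Definition _ := GRing.Lmodule.on (bt_spec x0).

Fact bt_spec_oner_neq0 : (1 : bt_spec x0) != 0.
Proof.
pose g (e : bt_alg) (b : F) := laurent_eval x0 (bt_aug e) * b.
apply/eqP => /tens_piP h.
have := @tens_eq_sum _ _ _ _ _ g _ _ _ _ _ h; rewrite big_seq1 big_nil.
rewrite /g bt_aug1 rmorph1 mulr1 => h1.
suff /eqP : (1 : F) = 0 by rewrite oner_eq0.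
apply: h1 => *.
- by rewrite bt_augD rmorphD mulrDl.
- by rewrite mulrDr.
- by rewrite bt_augZ rmorphM [RHS]mulrCA mulrA.
Qed.

HB.instance Definition _ :=
  GRing.PzSemiRing_isNonZero.Build (bt_spec x0) bt_spec_oner_neq0.
HB.instance Definition _ := GRing.Lmodule_isLalgebra.Build F (bt_spec x0)
  (@tens_scalerAl _ bt_alg _ (laurent_eval x0)).
HB.instance Definition _ := GRing.Lalgebra_isAlgebra.Build F (bt_spec x0)
  (@tens_scalerAr _ bt_alg _ (laurent_eval x0)).

End Spec.
End BraidsTies.

Local Open Scope classical_set_scope.

Section Semisimple.
Variables (S : pzRingType) (V : lmodType S).

Definition is_submodule (W : set V) : Prop :=
  [/\ W 0, forall v w, W v -> W w -> W (v + w)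
    & forall a v, W v -> W (a *: v)].

Definition is_simple_submodule (W : set V) : Prop :=
  [/\ is_submodule W, W != [set 0]
    & forall W', is_submodule W' -> W' `<=` W -> W' = [set 0] \/ W' = W].

(* The direct sum may be infinite, so both clauses range over finite partial
   sums of a family w with w i in W i. *)
Definition semisimple_module : Prop :=
  exists (I : choiceType) (W : I -> set V),
  [/\ forall i, is_simple_submodule (W i),
      forall v, exists (s : seq I) (w : I -> V),
        (forall i, W i (w i)) /\ v = \sum_(i <- s) w i
    & forall (s : seq I) (w : I -> V), uniq s -> (forall i, W i (w i)) ->
        \sum_(i <- s) w i = 0 -> forall i, i \in s -> w i = 0].

End Semisimple.

Definition semisimple_ring (S : nzRingType) : Prop := semisimple_module S^o.

Definition zariski_closed (F : fieldType) (Z : set F) : Prop :=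
  exists P : set {poly F}, Z = [set x | forall p, P p -> p.[x] = 0].

Definition zariski_open (F : fieldType) (U : set F) : Prop :=
  zariski_closed (~` U).

(* Main.v *)
Require Import Defs.
From mathcomp Require Import all_boot all_order all_algebra.
From mathcomp Require Import boolp classical_sets reals complex.
From mathcomp Require Import zify.

(** At [u = 1] the [T i] are involutions that permute, by conjugation, finitely
    many commuting idempotents built from the [E i], and the algebra is
    semisimple by averaging, as in Maschke's theorem. The averaging argument can
    be deformed in [u], without knowing a basis or a faithful representation of
    the algebra.

    The tool is a Casimir element: a tensor [c], the sum of some [x (x) y], with
    [a c = c a] for every element [a] of the algebra. If [p] is a linear
    projection onto a left ideal [W], then [s |-> sum of x * p (y * s)] commutes
    with left multiplication, has its values in [W], and is on [W]
    multiplication by the central element [z = sum of x * y]. So as soon as [z]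
    is invertible, [W] has a complement ([maschke]); in finite dimension this
    gives a decomposition into simple submodules ([complemented_semisimple]).

    The Casimir element is built along the symmetric group. Conjugating the
    [E i] gives an idempotent [tie a b] for each pair of points, with
    [T i * tie a b = tie (s_i a) (s_i b) * T i] ([swap_tie]); these idempotents
    commute ([tie_comm]), so their products have an evident Casimir element
    ([tie_casimir]). The group on [k + 2] points is the union of the cosets
    [s_j s_(j+1) ... s_k G], with [G] the group on [k + 1] points and
    [0 <= j <= k + 1]; accordingly the tensor is extended by summing
    [T j ... T k * x (x) y * T' k ... T' j], where
    [T' i = T i * (1 + (u^-1 - 1) * E i)]. The weight in [T' i] is the one for
    which [1 (x) 1 + T i (x) T' i] commutes with [T i], whatever [E i] is
    ([casimir_pair]); the braid relations take care of the other cosets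
    ([casimir_extend_gen]).

    It remains to see that [z] is invertible for almost all values of [u]. Since
    [T i * T' i] is 1 modulo [u - 1], the element [z] is [n!] modulo [u - 1]
    ([casimir_value_near]). The same coset decomposition gives a finite family
    that spans the algebra over the Laurent polynomials ([scalar_span_all]). On
    it [z] acts by a matrix [n! + (u - 1) Y], and Cramer's rule shows that [z]
    divides the determinant [h] of that matrix ([det_multiple]). Now [h] takes
    at [u = 1] a power of [n!] as its value, so it is a nonzero Laurent
    polynomial, and [z] is invertible at every [x <> 0] with [h(x) <> 0]
    ([fibre_semisimple]). *)

Set Implicit Arguments.
Unset Strict Implicit.
Unset Printing Implicit Defensive.
Import GRing.Theory Num.Theory.
Local Open Scope ring_scope.

(** * The relations of the algebra of braids and ties *)

Definition adjacent (i j : nat) : bool := (i == j.+1) || (j == i.+1).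
Definition apart (i j : nat) : bool := (i.+1 < j)%N || (j.+1 < i)%N.

(** The relations for families indexed by [nat], of which only the first [m]
    members count, in a ring where the parameter is a ring element. *)
Record braids_ties (M : pzRingType) (u : M) (m : nat)
    (T E : nat -> M) : Prop := BraidsTies {
  bt_TTC : forall i j, (i < m)%N -> (j < m)%N -> apart i j -> T i * T j = T j * T i;
  bt_EEC : forall i j, (i < m)%N -> (j < m)%N -> E i * E j = E j * E i;
  bt_EE : forall i, (i < m)%N -> E i * E i = E i;
  bt_ETC : forall i, (i < m)%N -> E i * T i = T i * E i;
  bt_ETfar : forall i j, (i < m)%N -> (j < m)%N -> apart i j -> E i * T j = T j * E i;
  bt_braid : forall i j, (i < m)%N -> (j < m)%N -> adjacent i j ->
    T i * T j * T i = T j * T i * T j;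
  bt_ETT : forall i j, (i < m)%N -> (j < m)%N -> adjacent i j ->
    E j * T i * T j = T i * T j * E i;
  bt_EETl : forall i j, (i < m)%N -> (j < m)%N -> adjacent i j ->
    E i * E j * T j = E i * T j * E i;
  bt_EETr : forall i j, (i < m)%N -> (j < m)%N -> adjacent i j ->
    E i * T j * E i = T j * E i * E j;
  bt_quad : forall i, (i < m)%N -> T i * T i = 1 + (u - 1) * (E i * (1 - T i)) }.

(** Rewriting with an equation between products inside a longer product that is
   associated to the left. *)
Lemma mulL2 (R : pzRingType) (a b c : R) : a * b = c -> forall x, x * a * b = x * c.
Proof. by move=> <- x; rewrite mulrA. Qed.

Lemma mulL3 (R : pzRingType) (a b c d : R) :
  a * b * c = d -> forall x, x * a * b * c = x * d.
Proof. by move=> <- x; rewrite !mulrA. Qed.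

(** * Sliding a generator through a product of consecutive generators *)

Section Sweep.
Variables (R : pzRingType) (t : nat -> R).

(** The word [t j ... t k] intertwines [x] and [y] as soon as its two consecutive
    letters [t i] and [t i.+1] do: [y] passes the letters before them and [x] the
    letters after them. *)
Lemma sweep_shift (x y : R) (j i k : nat) : (j <= i < k)%N ->
    (forall l, (j <= l < i)%N -> GRing.comm y (t l)) ->
    y * t i * t i.+1 = t i * t i.+1 * x ->
    (forall l, (i.+1 < l <= k)%N -> GRing.comm x (t l)) ->
  y * \prod_(j <= l < k.+1) t l = (\prod_(j <= l < k.+1) t l) * x.
Proof.
move=> /andP[ji ik] yt xy xt.
rewrite (big_cat_nat (n := i)) //=; last lia.
rewrite (big_ltn (m := i)); last lia.
rewrite (big_ltn (m := i.+1)); last lia.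
set a := \prod_(j <= l < i) t l; set b := \prod_(i.+2 <= l < k.+1) t l.
have ya : y * a = a * y.
  rewrite /a big_nat_cond; apply: commr_prod => l; rewrite andbT; exact: yt.
have xb : x * b = b * x.
  rewrite /b big_nat_cond; apply: commr_prod => l; rewrite andbT => ?; apply: xt; lia.
by rewrite !mulrA ya (mulL3 xy) !mulrA (mulL2 xb) !mulrA.
Qed.

End Sweep.

(** * The idempotents attached to pairs of points *)

(* [K] stands for the scalars, a set of central elements such as the image of a
   ground ring in an algebra [M]. *)
Section Ties.
Variables (M : pzRingType) (u v : M) (m : nat) (T E : nat -> M).
Variable K : M -> Prop.
Hypotheses (KC : forall k, K k -> forall x, GRing.comm x k) (Ku : K u) (Kv : K v).
Hypothesis uv : u * v = 1.
Hypothesis rel : braids_ties u m T E.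

Let u1C x : GRing.comm x (u - 1).
Proof. by apply: commrB; [exact: KC|exact: commr1]. Qed.
Let v1C x : GRing.comm x (v - 1).
Proof. by apply: commrB; [exact: KC|exact: commr1]. Qed.

(** Locked, since unification would otherwise expose its product to [mulrA]. *)
Definition Tinv (i : nat) : M :=
  locked ((T i + (u - 1) * E i) * (1 + (v - 1) * E i)).

Lemma uv1 : u - 1 + (v - 1) + (u - 1) * (v - 1) = 0.
Proof.
rewrite mulrBr mulr1 mulrBl mul1r uv -(opprB v 1) -opprD [in X in _ - X]addrC.
exact: subrr.
Qed.

(** As [x] is idempotent, [1 + (u - 1) * x] is [u] on the image of [x] and 1 on
    the image of [1 - x]. *)
Lemma idem_scale_inv (x : M) : x * x = x ->
  (1 + (u - 1) * x) * (1 + (v - 1) * x) = 1.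
Proof.
move=> xx; rewrite mulrDl mul1r mulrDr mulr1 -addrA.
have -> : (u - 1) * x * ((v - 1) * x) = (u - 1) * (v - 1) * x.
  by rewrite mulrA (mulL2 (v1C x)) mulrA -[RHS](mulL2 xx).
rewrite -!mulrDl addrA [_ + (u - 1)]addrC uv1 mul0r addr0 //.
Qed.

Lemma T_Tinv i : (i < m)%N -> T i * Tinv i = 1.
Proof.
move=> im; rewrite /Tinv -lock mulrA [T i * (_ + _)]mulrDr (bt_quad rel) //.
rewrite (_ : _ + T i * _ = 1 + (u - 1) * E i); first exact/idem_scale_inv/(bt_EE rel).
rewrite (mulrA (T i)) u1C -mulrA -addrA -mulrDr [E i * _]mulrBr mulr1.
by rewrite (bt_ETC rel) // subrK.
Qed.

Lemma Tinv_T i : (i < m)%N -> Tinv i * T i = 1.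
Proof.
move=> im; rewrite -(T_Tinv im); apply: commr_sym.
have TE := commr_sym (bt_ETC rel im).
by rewrite /Tinv -lock; apply: commrM; apply: commrD; try apply: commrM;
  first exact: commr_refl; try exact: commr1.
Qed.

Lemma comm_inv i x : (i < m)%N -> GRing.comm x (T i) -> GRing.comm x (Tinv i).
Proof.
move=> im xT; rewrite /GRing.comm -[LHS]mul1r -(Tinv_T im) -mulrA.
by congr (_ * _); rewrite mulrA -xT -mulrA T_Tinv // mulr1.
Qed.

(** By the quadratic relation [T i * T i] is a combination of 1, [E i] and
    [E i * T i]; the relations between [E i], [E j] and [T i] make the last
    commute with [E j]. Hence conjugation by [T i] acts on ties as an
    involution, although [T i] is not one. *)
Lemma bt_sqC_E i j : (i < m)%N -> (j < m)%N -> adjacent i j ->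
  GRing.comm (E j) (T i * T i).
Proof.
move=> im jm ij; have ji : adjacent j i by rewrite /adjacent orbC.
rewrite (bt_quad rel) //; apply: commrD; first exact: commr1.
apply: commrM => //; rewrite /GRing.comm.
rewrite !mulrBr !mulrBl !mulr1. rewrite (bt_EEC rel jm im); congr (_ - _).
rewrite mulrA (bt_EETl rel) // (bt_EETr rel) // (mulL2 (bt_EEC rel jm im)).
by rewrite mulrA (bt_ETC rel).
Qed.

(** For [a < b], the conjugate of [E a] by [T b.-1 ... T a.+1]. The value 1 for
    [b <= a] makes the conjugation rule below hold for coinciding points too. *)
Fixpoint tie_up (a b : nat) : M :=
  if b is c.+1 then
    if a == c then E a
    else if (a < c)%N then T c * tie_up a c * Tinv c else 1
  else 1.

Lemma tie_up_ge a b : (b <= a)%N -> tie_up a b = 1.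
Proof. by case: b => //= c ca; rewrite !ifN //; lia. Qed.

Lemma tie_upS a : tie_up a a.+1 = E a.
Proof. by rewrite /= eqxx. Qed.

Lemma tie_up_rec a c : (a < c)%N -> tie_up a c.+1 = T c * tie_up a c * Tinv c.
Proof. by move=> ac /=; rewrite ifN ?ac //; lia. Qed.

Lemma tie_up_ind (P : nat -> M -> Prop) a :
    ((a < m)%N -> P a.+1 (E a)) ->
    (forall c, (a < c < m)%N -> P c (tie_up a c) ->
       P c.+1 (T c * tie_up a c * Tinv c)) ->
  forall b, (a < b <= m)%N -> P b (tie_up a b).
Proof.
move=> P0 PS; elim=> // c IHc /andP[]; rewrite ltnS leq_eqVlt => /predU1P[<- am|ac cm].
  by rewrite tie_upS; apply: P0.
by rewrite tie_up_rec //; apply: PS; [rewrite ac cm|apply: IHc; rewrite ac ltnW].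
Qed.

Lemma commM3 (x y z t : M) : GRing.comm x y -> GRing.comm x z -> GRing.comm x t ->
  GRing.comm x (y * z * t).
Proof. by move=> xy xz xt; do !apply: commrM. Qed.

Lemma tie_far i a b : (i < m)%N -> (a < b <= m)%N -> (i.+1 < a)%N || (b < i)%N ->
  GRing.comm (T i) (tie_up a b).
Proof.
move=> im ab iab; move: b ab iab.
apply: (tie_up_ind (P := fun b x =>
  (i.+1 < a)%N || (b < i)%N -> GRing.comm (T i) x)) => [am|c acm IHc] iab.
  apply/commr_sym/(bt_ETfar rel); rewrite /apart; lia.
have TC : GRing.comm (T i) (T c) by apply: (bt_TTC rel); rewrite /apart; lia.
by apply: commM3 => //; [apply: IHc; lia|apply: comm_inv => //; lia].
Qed.

Lemma conj_braid i j : (i < m)%N -> (j < m)%N -> adjacent i j ->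
  Tinv i * T j * T i = T j * T i * Tinv j.
Proof.
move=> im jm ij; have ji : adjacent j i by rewrite /adjacent orbC.
rewrite -[LHS]mulr1 -(T_Tinv jm) !mulrA (mulL3 (bt_braid rel jm im ji)).
by rewrite !mulrA Tinv_T // mul1r.
Qed.

Lemma braid_inv i j : (i < m)%N -> (j < m)%N -> adjacent i j ->
  T j * Tinv i * Tinv j = Tinv i * Tinv j * T i.
Proof.
move=> im jm ij.
have -> : Tinv i * Tinv j * T i =
    Tinv i * Tinv j * (T i * T j * T i) * Tinv i * Tinv j.
  by rewrite !mulrA (mulL2 (T_Tinv im)) mulr1 (mulL2 (T_Tinv jm)) mulr1.
rewrite (bt_braid rel) // !mulrA (mulL2 (Tinv_T jm)) mulr1.
by rewrite Tinv_T // mul1r.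
Qed.

(** By induction on [b]: conjugation by [T c] turns the square of [T c.+1] into
    [T c.+1 * (T c * T c) * Tinv c.+1], whose factors commute with the tie of
    [a] and [c]. *)
Lemma tie_sq_hi a b : (a < b < m)%N -> GRing.comm (T b * T b) (tie_up a b).
Proof.
move=> /andP[ab bm]; have abm : (a < b <= m)%N by lia.
move: b abm {ab} bm.
apply: (tie_up_ind (P := fun b x => (b < m)%N -> GRing.comm (T b * T b) x))
  => [am am1|c /andP[ac cm] IHc c1m].
  by apply/commr_sym/bt_sqC_E => //; rewrite /adjacent; lia.
have adj : adjacent c c.+1 by rewrite /adjacent eqxx orbT.
have fc : GRing.comm (T c.+1) (tie_up a c) by apply: tie_far => //; lia.
have sq : Tinv c * (T c.+1 * T c.+1) * T c = T c.+1 * (T c * T c) * Tinv c.+1.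
  have cb := conj_braid cm c1m adj.
  have -> : Tinv c * (T c.+1 * T c.+1) * T c =
      Tinv c * T c.+1 * T c * (Tinv c * T c.+1 * T c).
    by rewrite !mulrA (mulL2 (T_Tinv cm)) mulr1.
  by rewrite cb !mulrA (mulL2 (Tinv_T c1m)) mulr1.
set x := tie_up a c in IHc fc *.
have xY : x * (T c.+1 * (T c * T c) * Tinv c.+1) = T c.+1 * (T c * T c) * Tinv c.+1 * x.
  apply: commM3; [exact: commr_sym|apply: commr_sym; apply: IHc; lia|].
  exact/comm_inv/commr_sym.
rewrite -sq in xY; rewrite /GRing.comm.
have -> : T c.+1 * T c.+1 * (T c * x * Tinv c) =
    T c * (Tinv c * (T c.+1 * T c.+1) * T c * x) * Tinv c.
  by rewrite !mulrA T_Tinv // mul1r.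
by rewrite -xY !mulrA (mulL2 (T_Tinv cm)) mulr1.
Qed.

Lemma tie_sq_lo a b : (a.+1 < b <= m)%N -> GRing.comm (T a * T a) (tie_up a.+1 b).
Proof.
move: b; apply: (tie_up_ind (P := fun b x => GRing.comm (T a * T a) x)) => [am|c acm IHc].
  by apply/commr_sym/bt_sqC_E; rewrite /adjacent; lia.
have ac : GRing.comm (T c) (T a) by apply: (bt_TTC rel); rewrite /apart; lia.
have ac2 : GRing.comm (T a * T a) (T c) by apply/commr_sym/commrM.
by apply: commM3 => //; apply: comm_inv => //; lia.
Qed.

Lemma tie_lo a b : (a.+1 < b <= m)%N -> T a * tie_up a b = tie_up a.+1 b * T a.
Proof.
move: b; apply: (tie_up_ind (P := fun b x => T a * tie_up a b = x * T a)) => [am|c acm IHc].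
  rewrite tie_up_rec // tie_upS !mulrA -(bt_ETT rel) //; try by rewrite /adjacent; lia.
  by rewrite -mulrA T_Tinv ?mulr1 //; lia.
rewrite tie_up_rec; last lia.
have ac : GRing.comm (T a) (T c) by apply: (bt_TTC rel); rewrite /apart; lia.
have aic : GRing.comm (T a) (Tinv c) by apply: comm_inv => //; lia.
by rewrite !mulrA ac (mulL2 IHc) !mulrA (mulL2 aic) !mulrA.
Qed.

Lemma tie_lo_sym a b : (a.+1 < b <= m)%N -> T a * tie_up a.+1 b = tie_up a b * T a.
Proof.
move=> ab; have am : (a < m)%N by lia.
rewrite -[RHS]mul1r -(Tinv_T am) -!mulrA (mulrA (T a) (tie_up a b)) tie_lo //.
by rewrite -[_ * _ * T a]mulrA -(tie_sq_lo ab) !mulrA Tinv_T // mul1r.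
Qed.

Lemma tie_hi a b : (a < b < m)%N -> T b * tie_up a b = tie_up a b.+1 * T b.
Proof.
move=> /andP[ab bm]; rewrite tie_up_rec // -[RHS]mulrA Tinv_T ?mulr1 //.
Qed.

Lemma tie_hi_sym a b : (a < b < m)%N -> T b * tie_up a b.+1 = tie_up a b * T b.
Proof.
move=> ab; have bm : (b < m)%N by lia.
rewrite tie_up_rec; last lia.
by rewrite !mulrA tie_sq_hi // -[LHS]mulrA (mulL2 (T_Tinv bm)) mulr1.
Qed.

(** The innermost conjugations [T i.+1 * T i] turn [T i] into [T i.+1], which
    commutes with the tie of [a] and [i]. *)
Lemma tie_mid a i b : (a < i)%N -> (i.+1 < b <= m)%N ->
  GRing.comm (T i) (tie_up a b).
Proof.
move=> ai /andP[]; elim: b => // b IHb; rewrite ltnS leq_eqVlt => /predU1P[<- im|ib bm].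
  have im' : (i < m)%N by lia.
  have adj : adjacent i i.+1 by rewrite /adjacent eqxx orbT.
  have adj' : adjacent i.+1 i by rewrite /adjacent eqxx.
  have fc : GRing.comm (T i.+1) (tie_up a i) by apply: tie_far; lia.
  rewrite tie_up_rec ?tie_up_rec; try lia.
  rewrite /GRing.comm !mulrA (bt_braid rel) // -(mulrA _ _ (tie_up a i)) fc.
  by rewrite !mulrA (mulL3 (braid_inv im' im adj)) !mulrA.
have ib' : GRing.comm (T i) (T b) by apply: (bt_TTC rel); rewrite /apart; lia.
rewrite tie_up_rec; last lia.
by apply: commM3 => //; [apply: IHb; lia|apply: comm_inv => //; lia].
Qed.

Definition swap (i x : nat) : nat :=
  if x == i then i.+1 else if x == i.+1 then i else x.

Definition tie (a b : nat) : M := if (a < b)%N then tie_up a b else tie_up b a.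

Lemma tieC a b : tie a b = tie b a.
Proof. by rewrite /tie; case: ltngtP => // ->. Qed.

Lemma tie_diag a : tie a a = 1.
Proof. by rewrite /tie ltnn tie_up_ge. Qed.

Lemma tieS i : tie i i.+1 = E i.
Proof. by rewrite /tie ltnSn tie_upS. Qed.

(** Raising the upper end of a pair is the definition of the ties, and raising
    the lower end comes from the relation between [E j * T i * T j] and
    [T i * T j * E i]; the inverse moves follow since the square of [T i]
    commutes with the tie. A pair that [swap i] fixes has a tie that commutes
    with [T i]. *)
Lemma swap_tie_lt i a b : (i < m)%N -> (a < b <= m)%N ->
  T i * tie a b = tie (swap i a) (swap i b) * T i.
Proof.
move=> im ab; have [iab|iab] := boolP ((i.+1 < a)%N || (b < i)%N).
  rewrite /swap !ifN; try lia; rewrite /tie ifT; last lia.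
  exact: tie_far.
have [ib|] := eqVneq i b.
  rewrite /swap ib eqxx !ifN; try lia; rewrite /tie !ifT; try lia.
  by apply: tie_hi; lia.
have [-> _|ia ib] := eqVneq i a.
  rewrite /swap eqxx; have [->|ba] := eqVneq b a.+1.
    by rewrite ifN ?[tie a.+1 a]tieC ?tieS ?(bt_ETC rel) //; lia.
  rewrite !ifN /tie ?ifT; try lia; apply: tie_lo; lia.
have [aE|ia'] := eqVneq a i.+1.
  rewrite aE /swap eqxx ifN; last lia.
  rewrite !ifN /tie ?ifT; try lia; apply: tie_lo_sym; lia.
have [bE|ib'] := eqVneq b i.+1.
  rewrite bE /swap eqxx !ifN; try lia.
  rewrite /tie ?ifT; try lia; apply: tie_hi_sym; lia.
rewrite /swap !ifN; try lia; rewrite /tie !ifT; try lia.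
apply: tie_mid; lia.
Qed.

Lemma swap_tie i a b : (i < m)%N -> (a <= m)%N -> (b <= m)%N ->
  T i * tie a b = tie (swap i a) (swap i b) * T i.
Proof.
move=> im am bm; case: (ltngtP a b) => ab.
- by apply: swap_tie_lt => //; rewrite ab.
- by rewrite tieC [RHS]/= [tie (swap i a) _]tieC; apply: swap_tie_lt; rewrite ?ab.
- by rewrite ab !tie_diag mulr1 mul1r.
Qed.

Lemma swapK i : involutive (swap i).
Proof.
move=> x; rewrite /swap.
by case: (x =P i) => ?; [|case: (x =P i.+1) => ?]; do ?case: ifP; lia.
Qed.

Lemma swap_le i x : (i < m)%N -> (x <= m)%N -> (swap i x <= m)%N.
Proof. by rewrite /swap => im xm; do ?case: ifP; lia. Qed.

Lemma tie_idem a b : (a <= m)%N -> (b <= m)%N -> tie a b * tie a b = tie a b.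
Proof.
wlog ab : a b / (a < b)%N => [H am bm|am bm].
  case: (ltngtP a b) => ab; [exact: H|rewrite tieC; exact: H|].
  by rewrite ab tie_diag mulr1.
rewrite /tie ab; have : (a < b <= m)%N by rewrite ab.
move: b {ab bm}; apply: (tie_up_ind (P := fun b x => x * x = x)) => [am'|c acm IHc].
  exact: bt_EE rel _ _.
have cm : (c < m)%N by lia.
by rewrite !mulrA (mulL2 (Tinv_T cm)) mulr1 (mulL2 IHc).
Qed.

Lemma tie_comm_swap i a b c d : (i < m)%N ->
    (a <= m)%N -> (b <= m)%N -> (c <= m)%N -> (d <= m)%N ->
    GRing.comm (tie (swap i a) (swap i b)) (tie (swap i c) (swap i d)) ->
  GRing.comm (tie a b) (tie c d).
Proof.
move=> im am bm cm dm; rewrite /GRing.comm => h.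
have e x y : (x <= m)%N -> (y <= m)%N ->
    tie x y = Tinv i * tie (swap i x) (swap i y) * T i.
  by move=> xm ym; rewrite -mulrA -swap_tie // mulrA Tinv_T // mul1r.
rewrite (e a b) // (e c d) // !mulrA (mulL2 (T_Tinv im)) mulr1.
by rewrite -(mulrA _ _ (tie (swap i c) _)) h !mulrA (mulL2 (T_Tinv im)) mulr1.
Qed.

(** Two pairs of points may be replaced by their images under [f] when proving
    that their ties commute. Compositions of adjacent transpositions have this
    property, and bring any four points to the first four. *)
Definition reduction (f : nat -> nat) : Prop :=
  [/\ injective f, forall x, (x <= m)%N -> (f x <= m)%N
    & forall a b c d, (a <= m)%N -> (b <= m)%N -> (c <= m)%N -> (d <= m)%N ->
      GRing.comm (tie (f a) (f b)) (tie (f c) (f d)) -> GRing.comm (tie a b) (tie c d)].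

Lemma reduction_swap i : (i < m)%N -> reduction (swap i).
Proof.
move=> im; split; [exact/inv_inj/swapK|by move=> x; apply: swap_le|].
by move=> a b c d am bm cm dm; apply: tie_comm_swap.
Qed.

Lemma reduction_comp f g : reduction f -> reduction g -> reduction (f \o g).
Proof.
move=> [fi fm fC] [gi gm gC]; split; first exact: inj_comp.
  by move=> x xm; apply/fm/gm.
by move=> a b c d am bm cm dm /fC h; apply: gC => //; apply: h; apply: gm.
Qed.

Lemma reduction_to k x : (k <= x <= m)%N ->
  exists2 f, reduction f & f x = k /\ forall y, (y < k)%N -> f y = y.
Proof.
move=> /andP[]; elim: x => [|x IHx]; rewrite leq_eqVlt => /predU1P[->|//] xm.
- by exists id; split=> // *.
- by exists id; split=> // *.
move=> xm'; have [f fr [fx fy]] := IHx xm (ltnW xm').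
exists (f \o swap x); first exact/reduction_comp/reduction_swap.
split=> [|y yk] /=; first by rewrite /swap eqxx ifN ?fx //; lia.
by rewrite /swap !ifN ?fy //; lia.
Qed.

(** After renumbering, the two pairs are among the points 0, 1, 2, 3 and the
    first is 0, 1; in each case a last transposition makes both ties generators
    [E i]. *)
Lemma tie_comm a b c d : (a <= m)%N -> (b <= m)%N -> (c <= m)%N -> (d <= m)%N ->
  GRing.comm (tie a b) (tie c d).
Proof.
have near12 k : (k <= m)%N -> (1 <= k)%N -> GRing.comm (tie 0 1) (tie 1 k).
  move=> km k1; have [<-|k1'] := eqVneq 1%N k.
    by rewrite tie_diag; exact: commr1.
  have [|f [_ fm fC] [fk fy]] := @reduction_to 2 k; first lia.
  apply: fC => //; try lia; rewrite (fy 0%N) // (fy 1%N) // fk !tieS.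
  by apply: (bt_EEC rel); lia.
have near01 k : (k <= m)%N -> (1 <= k)%N -> GRing.comm (tie 0 1) (tie 0 k).
  move=> km k1; have [<-|k1'] := eqVneq 1%N k; first exact: commr_refl.
  apply: (@tie_comm_swap 0) => //; try lia.
  rewrite {1 2 3}/swap /= [tie 1 0]tieC /swap !ifN; try lia.
  exact: near12.
have near0 k l : (k <= m)%N -> (l <= m)%N -> (1 <= m)%N -> GRing.comm (tie 0 1) (tie k l).
  wlog kl : k l / (k <= l)%N => [H km lm m1|km lm m1].
    by case: (leqP k l) => kl; [|rewrite [tie k l]tieC]; apply: H => //; lia.
  case: (posnP l) => [l0|l1]; first by rewrite (_ : k = l) ?tie_diag; [exact: commr1|lia].
  case: k kl km => [|[|k]] kl km; [exact: near01|exact: near12|].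
  have [<-|k1'] := eqVneq k.+2 l; first by rewrite tie_diag; exact: commr1.
  have [|f [fi fm fC] [fk fy]] := @reduction_to 2 k.+2; first lia.
  apply: fC => //; try lia; rewrite (fy 0%N) // (fy 1%N) // fk.
  have fl : (2 < f l <= m)%N.
    rewrite fm // andbT ltnNge; apply/negP => fl2.
    have [||] : [\/ f l = f 0, f l = f 1 | f l = f k.+2]%N.
    - by rewrite fk (fy 0%N) // (fy 1%N) //; case: (f l) fl2 => [|[|[|//]]] _; constructor.
    - by move/fi; lia.
    - by move/fi; lia.
    - by move/fi; lia.
  have [|g [_ gm gC] [gl gy]] := @reduction_to 3 (f l); first lia.
  apply: gC => //; try lia; rewrite (gy 0%N) // (gy 1%N) // (gy 2%N) // gl !tieS.
  by apply: (bt_EEC rel); lia.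
move=> am bm cm dm; have [<-|ab] := eqVneq a b.
  by rewrite tie_diag; exact/commr_sym/commr1.
have [|f [fi fm fC] [fa _]] := @reduction_to 0 a; first lia.
apply: fC => //; rewrite fa.
have fb : (0 < f b)%N by rewrite lt0n -fa (inj_eq fi) eq_sym.
have [|g [_ gm gC] [gb gy]] := @reduction_to 1 (f b); first by rewrite fb fm.
apply: gC => //; try exact: fm; rewrite gb gy //.
by apply: near0; [apply/gm/fm|apply/gm/fm|have := fm _ bm; lia].
Qed.

(** * Casimir elements *)

Definition tie_pair (p : nat * nat) : M := tie p.1 p.2.
Definition point_pairs : seq (nat * nat) :=
  [seq (a, b) | a <- iota 0 m.+1, b <- iota 0 m.+1].

Lemma mem_point_pairs p : (p \in point_pairs) = (p.1 <= m)%N && (p.2 <= m)%N.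
Proof.
case: p => a b; apply/allpairsP/idP => [[[c d] []]|/andP[am bm]].
  by rewrite !mem_iota => ? ? [-> ->]; lia.
by exists (a, b); rewrite !mem_iota; split=> //; move: am bm => /=; lia.
Qed.

Lemma tie_pairK p : p \in point_pairs -> tie_pair p * tie_pair p = tie_pair p.
Proof. by rewrite mem_point_pairs => /andP[]; apply: tie_idem. Qed.

Lemma tie_pairC p q : p \in point_pairs -> q \in point_pairs ->
  GRing.comm (tie_pair p) (tie_pair q).
Proof. by rewrite !mem_point_pairs => /andP[? ?] /andP[? ?]; apply: tie_comm. Qed.

Lemma gen_tie i : (i < m)%N -> exists2 p, p \in point_pairs & tie_pair p = E i.
Proof.
by move=> im; exists (i, i.+1); rewrite ?mem_point_pairs /tie_pair ?tieS //=; lia.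
Qed.

(** The partner of [T i] on the right of the tensor sign. For the group it would
    be the inverse of [T i]; the factor on the right is instead the inverse of
    [1 + (u - 1) * E i], the constant term of the quadratic relation. *)
Definition wT (i : nat) : M := locked (T i * (1 + (v - 1) * E i)).

Lemma wTE i : wT i = T i * (1 + (v - 1) * E i).
Proof. by rewrite /wT -lock. Qed.

Lemma EC_tie i p : (i < m)%N -> p \in point_pairs -> GRing.comm (tie_pair p) (E i).
Proof. by move=> /gen_tie[q qm <-] pm; apply: tie_pairC. Qed.

Definition swap_pair i (p : nat * nat) := (swap i p.1, swap i p.2).

Lemma swap_pair_point_pairs i p : (i < m)%N -> p \in point_pairs ->
  swap_pair i p \in point_pairs.
Proof. by rewrite !mem_point_pairs /= => im /andP[? ?]; rewrite !swap_le. Qed.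

Lemma tie_pair_swap i p : (i < m)%N -> p \in point_pairs ->
  tie_pair p * T i = T i * tie_pair (swap_pair i p).
Proof.
move=> im; rewrite mem_point_pairs => /andP[? ?].
by rewrite /tie_pair swap_tie ?swapK ?swap_le.
Qed.

Lemma tie_pair_wT i p : (i < m)%N -> p \in point_pairs ->
  tie_pair (swap_pair i p) * wT i = wT i * tie_pair p.
Proof.
move=> im pm; rewrite wTE mulrA tie_pair_swap //; last exact: swap_pair_point_pairs.
have -> : swap_pair i (swap_pair i p) = p.
  by case: p {pm} => a b; rewrite /swap_pair /= !swapK.
rewrite -!mulrA; congr (_ * _); apply: commrD; first exact: commr1.
by apply: commrM => //; apply: EC_tie.
Qed.

(** Tensors are encoded as lists of pairs and are compared by means of all
    balanced biadditive maps, that is, all maps out of the tensor product over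
    the scalars. *)
Definition balanced (V : zmodType) (f : M -> M -> V) : Prop :=
  [/\ forall x x' y, f (x + x') y = f x y + f x' y,
      forall x y y', f x (y + y') = f x y + f x y'
    & forall k, K k -> forall x y, f (x * k) y = f x (k * y)].

Definition casimir (c : seq (M * M)) (a : M) : Prop :=
  forall (V : zmodType) (f : M -> M -> V), balanced f ->
  \sum_(p <- c) f (a * p.1) p.2 = \sum_(p <- c) f p.1 (p.2 * a).

Lemma balanced_sand (V : zmodType) (f : M -> M -> V) r s :
  balanced f -> balanced (fun x y => f (r * x) (y * s)).
Proof.
case=> fl fr fK; split=> [x x' y|x y y'|k Kk x y].
- by rewrite ?mulrDr fl.
- by rewrite ?mulrDl fr.
- by rewrite ?(mulrA r) fK // ?(mulrA k).
Qed.

Lemma balanced_l (V : zmodType) (f : M -> M -> V) r :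
  balanced f -> balanced (fun x y => f (r * x) y).
Proof.
case=> fl fr fK; split=> [x x' y|x y y'|k Kk x y].
- by rewrite ?mulrDr fl.
- by rewrite ?mulrDl fr.
- by rewrite ?(mulrA r) fK // ?(mulrA k).
Qed.

Lemma balanced_r (V : zmodType) (f : M -> M -> V) s :
  balanced f -> balanced (fun x y => f x (y * s)).
Proof.
case=> fl fr fK; split=> [x x' y|x y y'|k Kk x y].
- by rewrite ?mulrDr fl.
- by rewrite ?mulrDl fr.
- by rewrite ?(mulrA r) fK // ?(mulrA k).
Qed.

Lemma balanced0l (V : zmodType) (f : M -> M -> V) y : balanced f -> f 0 y = 0.
Proof. by case=> fl _ _; apply: (addrI (f 0 y)); rewrite -fl !addr0. Qed.

Lemma balanced0r (V : zmodType) (f : M -> M -> V) x : balanced f -> f x 0 = 0.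
Proof. by case=> _ fr _; apply: (addrI (f x 0)); rewrite -fr !addr0. Qed.

Lemma balancedNl (V : zmodType) (f : M -> M -> V) x y : balanced f -> f (- x) y = - f x y.
Proof.
move=> bf; apply: (addrI (f x y)); case: (bf) => fl _ _.
by rewrite -fl !subrr balanced0l.
Qed.

Lemma balancedNr (V : zmodType) (f : M -> M -> V) x y : balanced f -> f x (- y) = - f x y.
Proof.
move=> bf; apply: (addrI (f x y)); case: (bf) => _ fr _.
by rewrite -fr !subrr balanced0r.
Qed.

Lemma casimirD c a b : casimir c a -> casimir c b -> casimir c (a + b).
Proof.
move=> ca cb V f bf; case: (bf) => fl fr _.
under eq_bigr do rewrite mulrDl fl; under [RHS]eq_bigr do rewrite mulrDr fr.
by rewrite !big_split ca // cb.
Qed.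

Lemma casimirN c a : casimir c a -> casimir c (- a).
Proof.
move=> ca V f bf; under eq_bigr do rewrite mulNr balancedNl //.
under [RHS]eq_bigr do rewrite mulrN balancedNr //.
by rewrite !sumrN ca.
Qed.

Lemma casimirM c a b : casimir c a -> casimir c b -> casimir c (a * b).
Proof.
move=> ca cb V f bf; under eq_bigr do rewrite -mulrA.
rewrite (cb _ (fun x y => f (a * x) y)) ?(ca _ (fun x y => f x (y * b))).
- by under eq_bigr do rewrite -mulrA.
- exact: balanced_r.
- exact: balanced_l.
Qed.

Lemma casimir1 c : casimir c 1.
Proof. by move=> V f bf; apply: eq_bigr => p _; rewrite mul1r mulr1. Qed.

Lemma casimir_scalar c k : K k -> casimir c k.
Proof.
move=> Kk V f [_ _ fK]; apply: eq_bigr => p _.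
by rewrite -(KC Kk) fK // (KC Kk).
Qed.

Lemma casimir_cat c d a : casimir c a -> casimir d a -> casimir (c ++ d) a.
Proof. by move=> ca da V f bf; rewrite !big_cat /= ca // da. Qed.

Definition sandwich (r s : M) (c : seq (M * M)) : seq (M * M) :=
  [seq (r * p.1, p.2 * s) | p <- c].

Lemma casimir_sandwich c a b r s :
  casimir c b -> a * r = r * b -> b * s = s * a -> casimir (sandwich r s c) a.
Proof.
move=> cb ar bs V f bf; rewrite !big_map /=.
under eq_bigr do rewrite mulrA ar -mulrA.
rewrite (cb _ (fun x y => f (r * x) (y * s))); last exact: balanced_sand.
by apply: eq_bigr => p _; rewrite -!mulrA bs.
Qed.

(** For one idempotent [e] the tensor [e (x) e + (1 - e) (x) (1 - e)] commutes
    with [e]; for commuting idempotents these tensors are composed. *)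
Fixpoint tie_casimir (l : seq (nat * nat)) : seq (M * M) :=
  if l is p :: l' then
    sandwich (tie_pair p) (tie_pair p) (tie_casimir l') ++
    sandwich (1 - tie_pair p) (1 - tie_pair p) (tie_casimir l')
  else [:: (1, 1)].

Lemma tie_casimirP l q : {subset l <= point_pairs} -> q \in l ->
  casimir (tie_casimir l) (tie_pair q).
Proof.
elim: l => // p l IHl lm; rewrite inE.
have pm : p \in point_pairs by apply: lm; rewrite mem_head.
have lm' : {subset l <= point_pairs} by move=> x xl; apply: lm; rewrite inE xl orbT.
case/predU1P => [->|ql].
  have e1 : tie_pair p * (1 - tie_pair p) = 0 by rewrite mulrBr mulr1 tie_pairK // subrr.
  have e2 : (1 - tie_pair p) * tie_pair p = 0 by rewrite mulrBl mul1r tie_pairK // subrr.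
  apply: casimir_cat => V f bf; rewrite !big_map /=; apply: eq_bigr => x _.
    by rewrite mulrA tie_pairK // -mulrA tie_pairK.
  by rewrite mulrA e1 mul0r -mulrA e2 mulr0 balanced0l // balanced0r.
have qm := lm' _ ql; have qp := tie_pairC qm pm; have cq := IHl lm' ql.
apply: casimir_cat; apply: casimir_sandwich cq _ _ => //.
- by apply: commrB => //; apply: commr1.
- by apply: commrB => //; apply: commr1.
Qed.

(** Write [q = 1 + (u - 1) * E i] and [p = (u - 1) * E i]. Then
    [T i * T i = q - p * T i], [q * wT i = T i] and [wT i * T i = 1 - wT i * p].
    In the commutator with [T i] the terms in [q] and 1 exchange the two halves
    of the tensor, and the terms in [p] cancel because [c] commutes with
    [E i]. *)
Lemma casimir_pair c i : (i < m)%N -> casimir c (E i) ->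
  casimir (c ++ sandwich (T i) (wT i) c) (T i).
Proof.
move=> im cE V f bf; case: (bf) => fl fr _; rewrite !big_cat /= !big_map /=.
have TE := bt_ETC rel im; have EEi := bt_EE rel im.
set q := 1 + (u - 1) * E i; set p := (u - 1) * E i; set q' := 1 + (v - 1) * E i.
have cp : casimir c p.
  apply: casimirM cE; apply: casimirD; [exact: casimir_scalar|exact/casimirN/casimir1].
have cq : casimir c q by apply: casimirD cp; exact: casimir1.
have qq' : q * q' = 1 by apply: idem_scale_inv.
have qC x : GRing.comm x (E i) -> GRing.comm x q.
  by move=> xE; apply: commrD; [exact: commr1|exact: commrM].
have q'C x : GRing.comm x (E i) -> GRing.comm x q'.
  by move=> xE; apply: commrD; [exact: commr1|exact: commrM].
have pC x : GRing.comm x (E i) -> GRing.comm x p by move=> xE; apply: commrM.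
have TT : T i * T i = q - p * T i.
  by rewrite (bt_quad rel) // mulrBr mulr1 mulrBr addrA /p mulrA.
have TpC : GRing.comm (T i) p by apply: pC.
have Tq'C : GRing.comm (T i) q' by apply: q'C.
have pwT : p * wT i = wT i * p.
  rewrite wTE.
  by apply: commrM; [exact: commr_sym|apply: q'C; apply/commr_sym/pC/commr_refl].
have qwT : q * wT i = T i.
  rewrite wTE -/q' mulrA (commr_sym (qC (T i) _)) -?mulrA ?qq' ?mulr1 //.
have wTT : wT i * T i = 1 - wT i * p.
  by rewrite -pwT wTE -/q' -mulrA -Tq'C mulrA TT mulrBl qq' -!mulrA.
have cpT : \sum_(x <- c) f (p * (T i * x.1)) (x.2 * wT i) =
           \sum_(x <- c) f (T i * x.1) (x.2 * wT i * p).
  have := casimir_sandwich cp (commr_sym TpC) pwT; move/(_ V f bf).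
  by rewrite !big_map.
have cqT : \sum_(x <- c) f (q * x.1) (x.2 * wT i) = \sum_(x <- c) f x.1 (x.2 * T i).
  rewrite (cq _ (fun x y => f x (y * wT i))); last exact: balanced_r.
  by apply: eq_bigr => x _; rewrite -mulrA qwT.
under [X in _ + X = _]eq_bigr => x _.
  rewrite mulrA TT mulrBl fl balancedNl // -[p * _ * _]mulrA.
  over.
under [X in _ = _ + X]eq_bigr => x _.
  rewrite -[x.2 * _ * _]mulrA wTT mulrBr mulr1 mulrA fr balancedNr //.
  over.
by rewrite !big_split !sumrN /= cpT cqT addrCA.
Qed.

Definition sweep_up (k j : nat) : M := \prod_(j <= l < k.+1) T l.
(** The converse ring reverses the order of the factors. *)
Definition sweep_down (k j : nat) : M := (\prod_(j <= l < k.+1) (wT l : M^c)) : M^c.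

Lemma sweep_up_top k : sweep_up k k.+1 = 1. Proof. by rewrite /sweep_up big_geq. Qed.
Lemma sweep_down_top k : sweep_down k k.+1 = 1. Proof. by rewrite /sweep_down big_geq. Qed.

Lemma sweep_up_rec k j : (j <= k)%N -> sweep_up k j = T j * sweep_up k j.+1.
Proof. by move=> jk; rewrite /sweep_up big_ltn. Qed.

Lemma sweep_down_rec k j : (j <= k)%N -> sweep_down k j = sweep_down k j.+1 * wT j.
Proof. by move=> jk; rewrite /sweep_down big_ltn. Qed.

Lemma wt_swap a b i : (i < m)%N -> (a <= m)%N -> (b <= m)%N ->
  (1 + (v - 1) * tie a b) * T i = T i * (1 + (v - 1) * tie (swap i a) (swap i b)).
Proof.
move=> im am bm; have ts := @tie_pair_swap i (a, b) im; rewrite /tie_pair /= in ts.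
rewrite mulrDl mulrDr mul1r mulr1 -mulrA ts ?mem_point_pairs /= ?am // mulrA.
by rewrite -(v1C (T i)) mulrA.
Qed.

(** Moving all weights to the right turns both sides into a word of the braid
    relation times the weights of the ties of [i] with [i.+1] and [i.+2]. *)
Lemma wT_braid i : (i.+1 < m)%N ->
  T i * wT i.+1 * wT i = wT i.+1 * wT i * T i.+1.
Proof.
move=> i1m; have im : (i < m)%N by lia.
have s1 : swap i i.+1 = i by rewrite /swap eqxx ifN //; lia.
have s0 : swap i i = i.+1 by rewrite /swap eqxx.
have s2 : swap i i.+2 = i.+2 by rewrite /swap !ifN //; lia.
have s1' : swap i.+1 i.+1 = i.+2 by rewrite /swap eqxx.
have s0' : swap i.+1 i = i by rewrite /swap !ifN //; lia.
have s2' : swap i.+1 i.+2 = i.+1 by rewrite /swap eqxx ifN //; lia.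
rewrite !wTE -!tieS.
set Q := fun a b => 1 + (v - 1) * tie a b.
rewrite -/(Q i i.+1) -/(Q i.+1 i.+2).
have h1 : Q i.+1 i.+2 * T i = T i * Q i i.+2.
  by rewrite /Q wt_swap ?s1 ?s2 //; lia.
have h2 : Q i i.+1 * T i.+1 = T i.+1 * Q i i.+2.
  by rewrite /Q wt_swap ?s0' ?s1' //; lia.
have h3 : Q i i.+2 * T i.+1 = T i.+1 * Q i i.+1.
  by rewrite /Q wt_swap ?s0' ?s2' //; lia.
have QC : Q i i.+1 * Q i i.+2 = Q i i.+2 * Q i i.+1.
  apply: commrD; first exact: commr1.
  apply: commrM => //; apply/commr_sym; apply: commrD; first exact: commr1.
  by apply: commrM => //; apply: tie_comm; lia.
rewrite !mulrA !(mulL2 h1) !mulrA (mulL2 h2) !mulrA (mulL2 h3) !mulrA.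
by rewrite (bt_braid rel) ?/adjacent ?eqxx ?orbT //; rewrite (mulL2 QC) !mulrA.
Qed.

Lemma TwTC i j : (i < m)%N -> (j < m)%N -> apart i j -> GRing.comm (T i) (wT j).
Proof.
move=> im jm ij; rewrite wTE; apply: commrM; first exact: bt_TTC rel _ _ _ _ _.
apply: commrD; first exact: commr1.
apply: commrM => //; apply/commr_sym/(bt_ETfar rel) => //.
by rewrite /apart orbC.
Qed.

Lemma sweep_up_low k i j : (k < m)%N -> (i.+1 < j)%N -> (i < m)%N ->
  T i * sweep_up k j = sweep_up k j * T i.
Proof.
move=> km ij im; rewrite /sweep_up big_nat_cond; apply: commr_prod => l /andP[/andP[? ?] _].
by apply: (bt_TTC rel); rewrite /apart; lia.
Qed.

Lemma sweep_down_low k i j : (k < m)%N -> (i.+1 < j)%N -> (i < m)%N ->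
  T i * sweep_down k j = sweep_down k j * T i.
Proof.
move=> km ij im; apply/esym; rewrite /sweep_down big_nat_cond.
apply: (@commr_prod M^c) => l /andP[/andP[? ?] _].
by apply/esym/TwTC; rewrite /apart; lia.
Qed.

Lemma sweep_up_shift k i j : (k < m)%N -> (j <= i < k)%N ->
  T i.+1 * sweep_up k j = sweep_up k j * T i.
Proof.
move=> km ijk; rewrite /sweep_up; apply: (sweep_shift ijk) => [l ?||l ?].
- by apply: (bt_TTC rel); rewrite /apart; lia.
- by rewrite (bt_braid rel) ?mulrA //; rewrite /adjacent; lia.
- by apply: (bt_TTC rel); rewrite /apart; lia.
Qed.

Lemma sweep_down_shift k i j : (k < m)%N -> (j <= i < k)%N ->
  T i * sweep_down k j = sweep_down k j * T i.+1.
Proof.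
move=> km ijk; rewrite /sweep_down; apply/esym.
apply: (@sweep_shift M^c wT (T i) (T i.+1) j i k ijk) => [l ?||l ?].
- by apply/esym/TwTC; rewrite /apart; lia.
- rewrite /GRing.mul /=.
by rewrite !mulrA wT_braid //; lia.
- by apply/esym/TwTC; rewrite /apart; lia.
Qed.

(** A tie crosses both halves of a coset summand with the same renumbering, since
    transpositions are involutions. *)
Lemma tie_sweep k j p : (k < m)%N -> (j <= k.+1)%N -> p \in point_pairs ->
  exists q, [/\ q \in point_pairs, tie_pair p * sweep_up k j = sweep_up k j * tie_pair q
    & tie_pair q * sweep_down k j = sweep_down k j * tie_pair p].
Proof.
move=> km; move: {2}(k.+1 - j)%N (erefl (k.+1 - j)%N) => d.
elim: d j p => [|d IHd] j p dE jk pm.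
  have -> : j = k.+1 by lia.
  by exists p; rewrite sweep_up_top sweep_down_top !mulr1 !mul1r.
have jm : (j < m)%N by lia.
have jk' : (j <= k)%N by lia.
have [|||q [qm qu qd]] := IHd j.+1 (swap_pair j p); [lia|lia|exact: swap_pair_point_pairs|].
exists q; rewrite (sweep_up_rec jk') (sweep_down_rec jk'); split; first exact: qm.
  by rewrite mulrA tie_pair_swap // -mulrA qu mulrA.
by rewrite mulrA qd -mulrA tie_pair_wT // mulrA.
Qed.

(** One summand for each coset of the group on [k + 1] points in the group on
    [k + 2] points. *)
Definition extend (k : nat) (c : seq (M * M)) : seq (M * M) :=
  flatten [seq sandwich (sweep_up k j) (sweep_down k j) c | j <- index_iota 0 k.+2].

Lemma casimir_extend_tie k c p : (k < m)%N -> p \in point_pairs ->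
    (forall q, q \in point_pairs -> casimir c (tie_pair q)) ->
  casimir (extend k c) (tie_pair p).
Proof.
move=> km pm cq V f bf; rewrite !big_flatten !big_map.
apply: eq_big_nat => j /andP[_ jk].
have jk' : (j <= k.+1)%N by [].
have [q [qm qu qd]] := tie_sweep km jk' pm.
exact: (casimir_sandwich (cq _ qm) qu qd).
Qed.

(** [T i] maps the coset of [j] to itself, up to a generator of the smaller
    group, unless [j] is [i] or [i.+1]; it exchanges the latter two cosets, and
    their summands together are the tensor of [casimir_pair]. *)
Lemma casimir_extend_gen k c i : (k < m)%N -> (i <= k)%N ->
    (forall q, q \in point_pairs -> casimir c (tie_pair q)) ->
    (forall l, (l < k)%N -> casimir c (T l)) ->
  casimir (extend k c) (T i).
Proof.
move=> km ik cq cT V f bf; rewrite !big_flatten !big_map.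
have im : (i < m)%N by lia.
have far j : (j < i)%N || (i.+1 < j <= k.+1)%N ->
    casimir (sandwich (sweep_up k j) (sweep_down k j) c) (T i).
  case/orP => [ji|ij].
    case: i ik im ji => // i ik im ji.
    apply: (casimir_sandwich (cT i _)); first lia.
      by apply: sweep_up_shift; lia.
    by apply: sweep_down_shift; lia.
  apply: (casimir_sandwich (cT i _)); first lia.
    by apply: sweep_up_low; lia.
  by apply: sweep_down_low; lia.
have split3 (F : nat -> V) : \sum_(0 <= j < k.+2) F j =
    \sum_(0 <= j < i) F j + (F i.+1 + F i) + \sum_(i.+2 <= j < k.+2) F j.
  rewrite (big_cat_nat (n := i)) //=; last lia.
  rewrite (big_ltn (m := i)); last lia.
  rewrite (big_ltn (m := i.+1)); last lia.
  by rewrite !addrA; congr (_ + _); rewrite addrAC.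
apply: etrans (split3 _) (esym (etrans (split3 _) (esym _))); congr (_ + _ + _).
- apply: eq_big_nat => j /andP[_ ji].
  by apply: far => //; rewrite ji.
- have cE : casimir (sandwich (sweep_up k i.+1) (sweep_down k i.+1) c) (E i).
    have [p pm <-] := gen_tie im.
    have [||q [qm qu qd]] := @tie_sweep k i.+1 p km; try done.
    exact: (casimir_sandwich (cq _ qm) qu qd).
  have := casimir_pair im cE bf; rewrite !big_cat !big_map /=.
  rewrite (sweep_up_rec ik) (sweep_down_rec ik).
  move=> h; apply: etrans (etrans _ h) _; congr (_ + _);
    by apply: eq_bigr => x _; rewrite ?mulrA.
- apply: eq_big_nat => j /andP[ij jk].
  by apply: far => //; apply/orP; right; rewrite ij.
Qed.

Fixpoint bt_casimir (k : nat) : seq (M * M) :=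
  if k is k'.+1 then extend k' (bt_casimir k') else tie_casimir point_pairs.

Lemma bt_casimir_tie k p : (k <= m)%N -> p \in point_pairs ->
  casimir (bt_casimir k) (tie_pair p).
Proof.
elim: k p => [|k IHk] p km pm; first exact: tie_casimirP.
by apply: casimir_extend_tie => // q; apply: IHk; exact: ltnW.
Qed.

Lemma bt_casimir_gen k i : (k <= m)%N -> (i < k)%N -> casimir (bt_casimir k) (T i).
Proof.
elim: k i => // k IHk i km ik; apply: casimir_extend_gen => // [q qm|l lk].
  by apply: bt_casimir_tie => //; exact: ltnW.
by apply: IHk => //; exact: ltnW.
Qed.

Definition casimir_value (c : seq (M * M)) : M := \sum_(p <- c) p.1 * p.2.

Lemma casimir_value_sandwich r s c :
  casimir_value (sandwich r s c) = r * casimir_value c * s.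
Proof.
rewrite /casimir_value big_map mulr_sumr mulr_suml; apply: eq_bigr => p _ /=.
by rewrite !mulrA.
Qed.

Lemma casimir_value_ties l : {subset l <= point_pairs} ->
  casimir_value (tie_casimir l) = 1.
Proof.
elim: l => [|p l IHl] lm; first by rewrite /casimir_value big_seq1 mulr1.
rewrite /casimir_value /= big_cat -!/(casimir_value _) !casimir_value_sandwich.
rewrite IHl; last first.
  by move=> x xl; apply: lm; rewrite inE xl orbT.
have pp : tie_pair p * tie_pair p = tie_pair p by apply/tie_pairK/lm/mem_head.
by rewrite /= !mulr1 mulrBr mulr1 mulrBl mul1r pp subrr subr0 addrC subrK.
Qed.

(** * The value of the Casimir element modulo u - 1 *)

Definition near_nat (x : M) (N : nat) : Prop := exists y, x = N%:R + (u - 1) * y.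

Lemma near_sum (n N : nat) (F : nat -> M) :
    (forall j, (j < n)%N -> near_nat (F j) N) ->
  near_nat (\sum_(0 <= j < n) F j) (n * N).
Proof.
elim: n => [|n IHn] h; first by exists 0; rewrite big_nil mulr0 addr0.
have [|y yE] := IHn; first by move=> j jn; apply: h; exact: ltnW.
have [z zE] := h n (ltnSn n); exists (y + z).
by rewrite big_nat_recr //= yE zE mulSn addnC natrD mulrDr addrACA.
Qed.

Lemma near_conj i x N : (i < m)%N -> near_nat x N -> near_nat (T i * x * wT i) N.
Proof.
move=> im [y ->]; exists (T i * y * wT i - E i * wT i *+ N).
have TwT : T i * wT i = 1 - (u - 1) * (E i * wT i).
  have EEi := bt_EE rel im; have TE := bt_ETC rel im.
  have qq' := idem_scale_inv EEi; rewrite wTE.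
  set q' := 1 + (v - 1) * E i in qq' *.
  rewrite mulrA (bt_quad rel) // [E i * _]mulrBr mulr1 [(u - 1) * (_ - _)]mulrBr.
  by rewrite addrA [LHS]mulrBl qq' -!mulrA.
rewrite [T i * (_ + _)]mulrDr mulrDl mulr_natr mulrnAl TwT mulrnBl.
rewrite (mulrA (T i)) u1C -!mulrA [in RHS]mulrBr mulrnAr.
by rewrite -addrA; congr (_ + _); rewrite addrC.
Qed.

Lemma near_sweep k j x N : (k < m)%N -> (j <= k.+1)%N -> near_nat x N ->
  near_nat (sweep_up k j * x * sweep_down k j) N.
Proof.
move=> km; move: {2}(k.+1 - j)%N (erefl (k.+1 - j)%N) => d.
elim: d j => [|d IHd] j dE jk xN.
  have -> : j = k.+1 by lia.
  by rewrite sweep_up_top sweep_down_top mulr1 mul1r.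
have jk' : (j <= k)%N by lia.
rewrite (sweep_up_rec jk') (sweep_down_rec jk').
have -> : T j * sweep_up k j.+1 * x * (sweep_down k j.+1 * wT j) =
    T j * (sweep_up k j.+1 * x * sweep_down k j.+1) * wT j by rewrite !mulrA.
by apply: near_conj; [lia|apply: IHd => //; lia].
Qed.

(** Each of the [k + 2] cosets contributes the preceding value up to a multiple
    of [u - 1], as [T i * wT i] is 1 modulo [u - 1]. *)
Lemma casimir_value_near k : (k <= m)%N ->
  near_nat (casimir_value (bt_casimir k)) (k.+1)`!.
Proof.
elim: k => [|k IHk] km; first by exists 0; rewrite mulr0 addr0; apply: casimir_value_ties.
have -> : casimir_value (bt_casimir k.+1) =
    \sum_(0 <= j < k.+2) sweep_up k j * casimir_value (bt_casimir k) * sweep_down k j.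
  rewrite /casimir_value big_flatten big_map; apply: eq_big_nat => j _.
  exact: casimir_value_sandwich.
rewrite factS; apply: near_sum => j jk.
by apply: near_sweep => //; apply: IHk; exact: ltnW.
Qed.

(** * A finite spanning family *)

Inductive scalar_span (s : seq M) : M -> Prop :=
| scalar_span_mem x : x \in s -> scalar_span s x
| scalar_span0 : scalar_span s 0
| scalar_spanD x y : scalar_span s x -> scalar_span s y -> scalar_span s (x + y)
| scalar_spanN x : scalar_span s x -> scalar_span s (- x)
| scalar_spanK k x : K k -> scalar_span s x -> scalar_span s (k * x).

Lemma scalar_span_mull a s t : (forall x, x \in s -> scalar_span t (a * x)) ->
  forall x, scalar_span s x -> scalar_span t (a * x).
Proof.
move=> h x; elim=> {x} [x||x y _|x _|k x Kk _].
- exact: h.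
- by rewrite mulr0; apply: scalar_span0.
- by move=> hx _ hy; rewrite mulrDr; apply: scalar_spanD.
- by move=> hx; rewrite mulrN; apply: scalar_spanN.
- by move=> hx; rewrite mulrA (KC Kk) -mulrA; apply: scalar_spanK.
Qed.

Lemma scalar_span_sub s t x : {subset s <= t} -> scalar_span s x -> scalar_span t x.
Proof.
move=> st xs; rewrite -[x]mul1r; apply: (scalar_span_mull _ xs) => y ys.
by rewrite mul1r; apply/scalar_span_mem/st.
Qed.

Fixpoint tie_products (l : seq (nat * nat)) : seq M :=
  if l is p :: l' then
    tie_products l' ++ [seq tie_pair p * x | x <- tie_products l']
  else [:: 1].

(** Coset representatives of the symmetric group times products of ties. *)
Fixpoint bt_words (k : nat) : seq M :=
  if k is k'.+1 then
    flatten [seq [seq sweep_up k' j * x | x <- bt_words k'] | j <- index_iota 0 k'.+2]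
  else tie_products point_pairs.

Lemma tie_products_closed l q x : {subset l <= point_pairs} -> q \in l ->
  scalar_span (tie_products l) x -> scalar_span (tie_products l) (tie_pair q * x).
Proof.
move=> lm ql; apply: scalar_span_mull => {x}; elim: l lm ql => // p l IHl lm.
have pm : p \in point_pairs by apply: lm; rewrite mem_head.
have lm' : {subset l <= point_pairs} by move=> x xl; apply: lm; rewrite inE xl orbT.
rewrite inE; case/predU1P => [->|ql] x; rewrite mem_cat => /orP[xl|/mapP[y yl ->]].
- by apply: scalar_span_mem; rewrite mem_cat map_f ?orbT.
- by rewrite mulrA tie_pairK //; apply: scalar_span_mem; rewrite mem_cat map_f ?orbT.
- by apply: scalar_span_sub (IHl lm' ql x xl) => z zl; rewrite mem_cat zl.
- rewrite mulrA (tie_pairC _ pm) -?mulrA; last exact: lm'.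
  apply: (scalar_span_mull _ (IHl lm' ql y yl)) => {}x xl.
  by apply: scalar_span_mem; rewrite mem_cat map_f ?orbT.
Qed.

Lemma bt_words_mem k j x : (j <= k.+1)%N -> x \in bt_words k ->
  sweep_up k j * x \in bt_words k.+1.
Proof.
move=> jk xk; apply/flatten_mapP; exists j; first by rewrite mem_index_iota.
exact: map_f.
Qed.

Lemma bt_words_tie k p x : (k <= m)%N -> p \in point_pairs ->
  scalar_span (bt_words k) x -> scalar_span (bt_words k) (tie_pair p * x).
Proof.
move=> km pm; elim: k km p pm x => [|k IHk] km p pm x; first exact: tie_products_closed.
apply: scalar_span_mull => {}x /flatten_mapP[j].
rewrite mem_index_iota => /andP[_ jk] /mapP[y yk ->].
have jk' : (j <= k.+1)%N by [].
have [q [qm qu _]] := tie_sweep km jk' pm; rewrite mulrA qu -mulrA.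
apply: (scalar_span_mull _ (IHk (ltnW km) q qm y (scalar_span_mem yk))) => z zk.
exact/scalar_span_mem/bt_words_mem.
Qed.

Lemma bt_words_E k i x : (k <= m)%N -> (i < m)%N ->
  scalar_span (bt_words k) x -> scalar_span (bt_words k) (E i * x).
Proof. by move=> km /gen_tie[p pm <-]; apply: bt_words_tie. Qed.

(** The case distinction is that of [casimir_extend_gen]; for [j = i] the
    quadratic relation brings in [E i], which stabilizes the span. *)
Lemma bt_words_T k i x : (k <= m)%N -> (i < k)%N ->
  scalar_span (bt_words k) x -> scalar_span (bt_words k) (T i * x).
Proof.
elim: k i x => // k IHk i x km ik; have im : (i < m)%N by lia.
apply: scalar_span_mull => {}x /flatten_mapP[j].
rewrite mem_index_iota => /andP[_ jk] /mapP[y yk ->].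
have pass l : (l < k)%N -> T i * sweep_up k j = sweep_up k j * T l ->
    scalar_span (bt_words k.+1) (T i * (sweep_up k j * y)).
  move=> lk e; rewrite mulrA e -mulrA.
  apply: (scalar_span_mull _ (IHk l y (ltnW km) lk (scalar_span_mem yk))) => z zk.
  exact/scalar_span_mem/bt_words_mem.
case: (ltngtP j i.+1) => ji.
- have [ji'|ij] := eqVneq j i.
    rewrite ji' sweep_up_rec // !mulrA (bt_quad rel) // -!mulrA.
    have wi : scalar_span (bt_words k.+1) (sweep_up k i.+1 * y).
      by apply/scalar_span_mem/bt_words_mem => //; lia.
    have wi' : scalar_span (bt_words k.+1) (T i * (sweep_up k i.+1 * y)).
      by rewrite mulrA -sweep_up_rec //; apply/scalar_span_mem/bt_words_mem => //; lia.
    rewrite mulrDl mul1r -mulrA mulrBl mul1r; apply: scalar_spanD => //.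
    have wE : scalar_span (bt_words k.+1) (E i * (1 - T i) * (sweep_up k i.+1 * y)).
      rewrite -mulrA mulrBl mul1r; apply: bt_words_E => //.
      by apply: scalar_spanD => //; apply: scalar_spanN.
    by apply: scalar_spanD; [exact: scalar_spanK|exact: scalar_spanN].
  case: i ik im ji pass ij => [|i] ik im ji pass ij; first by lia.
  by apply: (pass i); [lia|apply: sweep_up_shift; lia].
- by apply: (pass i); [lia|apply: sweep_up_low; lia].
- rewrite mulrA ji -sweep_up_rec //; apply/scalar_span_mem/bt_words_mem => //; lia.
Qed.

Lemma bt_words1 k : 1 \in bt_words k.
Proof.
elim: k => [|k IHk].
  rewrite [bt_words 0]/(tie_products point_pairs).
  by elim: point_pairs => [|p l IHl]; [exact: mem_head|rewrite mem_cat IHl].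
by rewrite -[1](mulr1) -{1}(sweep_up_top k); apply: bt_words_mem.
Qed.

Hypothesis gen : forall P : M -> Prop,
  (forall i, (i < m)%N -> P (T i)) -> (forall i, (i < m)%N -> P (E i)) ->
  (forall k, K k -> P k) -> (forall x y, P x -> P y -> P (x + y)) ->
  (forall x y, P x -> P y -> P (x * y)) -> forall x, P x.

Lemma scalar_span_all x : scalar_span (bt_words m) x.
Proof.
suff h a : forall y, scalar_span (bt_words m) y -> scalar_span (bt_words m) (a * y).
  by rewrite -[x]mulr1; apply/h/scalar_span_mem/bt_words1.
apply: (gen (P := fun a => forall y,
  scalar_span (bt_words m) y -> scalar_span (bt_words m) (a * y))).
- by move=> i im y; apply: bt_words_T.
- by move=> i im y; apply: bt_words_E.
- by move=> k Kk y; apply: scalar_spanK.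
- by move=> c d hc hd y ys; rewrite mulrDl; apply: scalar_spanD; [apply: hc|apply: hd].
- by move=> c d hc hd y ys; rewrite -mulrA; apply/hc/hd.
Qed.

Lemma bt_casimirP a : casimir (bt_casimir m) a.
Proof.
apply: gen a => [i im|i im|k Kk|x y|x y].
- exact: bt_casimir_gen.
- by have [p pm <-] := gen_tie im; apply: bt_casimir_tie.
- exact: casimir_scalar.
- exact: casimirD.
- exact: casimirM.
Qed.

Lemma casimir_value_central a : GRing.comm a (casimir_value (bt_casimir m)).
Proof.
rewrite /GRing.comm mulr_sumr mulr_suml.
under eq_bigr do rewrite mulrA; under [RHS]eq_bigr do rewrite -mulrA.
apply: (@bt_casimirP a _ (fun x y : M => x * y)).
by split=> *; rewrite ?mulrDl ?mulrDr ?mulrA.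
Qed.

End Ties.

(** * From complements of left ideals to semisimplicity *)

(** Take a matrix of maximal rank among those whose row space lies in [P]: adding
    to it a vector of [P] cannot raise the rank. *)
Lemma subspace_row_space (F : fieldType) (n : nat) (P : 'rV[F]_n -> Prop) :
    P 0 -> (forall x y, P x -> P y -> P (x + y)) ->
    (forall a x, P x -> P (a *: x)) ->
  exists A : 'M[F]_n, forall v, (v <= A)%MS <-> P v.
Proof.
move=> P0 PD PZ.
pose Q k := `[< exists2 A : 'M[F]_n, \rank A = k &
  forall v : 'rV_n, (v <= A)%MS -> P v >].
have Q0 : exists k, Q k.
  exists 0%N; apply/asboolP; exists 0; first exact: mxrank0.
  by move=> v; rewrite submx0 => /eqP->.
have Qn k : Q k -> (k <= n)%N by move/asboolP=> [A <- _]; exact: rank_leq_col.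
case: (ex_maxnP Q0 Qn) => k /asboolP[A rA AP] kmax.
exists A => v; split=> [|Pv]; first exact: AP.
have sAv : (A <= A + v)%MS := addsmxSl A v.
suff eqA : (A == A + v)%MS by rewrite (eqmxP eqA) addsmxSr.
rewrite -(mxrank_leqif_eq sAv) eqn_leq mxrankS //= rA.
apply: kmax; apply/asboolP; exists (A + v)%MS => // w /sub_addsmxP[[c d] /= ->].
apply: PD; first by apply: AP; exact: submxMl.
by rewrite [d]mx11_scalar mul_scalar_mx; exact: PZ.
Qed.

Section FiniteAlgebra.
Variables (F : fieldType) (S : algType F) (N : nat) (b : 'I_N -> S).
Hypothesis b_span : forall s, exists c : 'rV[F]_N, s = \sum_i c 0 i *: b i.
Local Open Scope classical_set_scope.

Local Notation submodule := (@is_submodule S S^o).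

Let phi (c : 'rV[F]_N) : S := \sum_i c 0 i *: b i.

Let phiD c d : phi (c + d) = phi c + phi d.
Proof. by rewrite -big_split; apply: eq_bigr => i _; rewrite mxE scalerDl. Qed.

Let phiZ a c : phi (a *: c) = a *: phi c.
Proof. by rewrite scaler_sumr; apply: eq_bigr => i _; rewrite mxE scalerA. Qed.

Let phi0 : phi 0 = 0.
Proof. by rewrite -(scale0r (0 : 'rV_N)) phiZ scale0r. Qed.

Lemma submodule_scale (W : set S^o) (a : F) (s : S) : submodule W -> W s -> W (a *: s).
Proof. by case=> _ _ WZ Ws; rewrite -[s]mul1r scalerAl; apply: WZ. Qed.

Lemma submodule_mx (W : set S^o) : submodule W ->
  exists A : 'M[F]_N, forall c, (c <= A)%MS <-> W (phi c).
Proof.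
move=> Wm; case: (Wm) => W0 WD _.
apply: subspace_row_space => [|x y|a x]; rewrite ?phi0 ?phiD ?phiZ //.
  exact: WD.
by apply: submodule_scale.
Qed.

(** Project the coordinates onto the preimage [A] of [W]. The relations between
    the [b i] lie in [A], where the projection is the identity, so the result
    does not depend on the choice of coordinates. *)
Lemma linear_projection (W : set S^o) : submodule W ->
  exists p : S -> S, [/\ forall s t, p (s + t) = p s + p t,
    forall a s, p (a *: s) = a *: p s, forall s, W (p s) & forall s, W s -> p s = s].
Proof.
move=> Wm; have [A AW] := submodule_mx Wm; case: (Wm) => W0 _ _.
pose Q := proj_mx A (A^C)%MS.
have Qid c : W (phi c) -> c *m Q = c.
  by move/AW => cA; apply: proj_mx_id => //; exact: capmx_compl.
have QW c : W (phi (c *m Q)) by apply/AW/proj_mx_sub.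
pose psi s := sval (cid (b_span s)).
have psiK s : phi (psi s) = s by rewrite /psi; case: cid.
have wd c d : phi c = phi d -> phi (c *m Q) = phi (d *m Q).
  move=> cd; have e0 : phi (c - d) = 0 by rewrite phiD -scaleN1r phiZ cd scaleN1r subrr.
  have := congr1 phi (Qid (c - d) _); rewrite e0 mulmxBl phiD -scaleN1r phiZ scaleN1r.
  by move/(_ W0)/eqP; rewrite subr_eq0 => /eqP.
exists (fun s => phi (psi s *m Q)); split=> [s t|a s|s|s Ws].
- by rewrite -phiD -mulmxDl; apply: wd; rewrite phiD !psiK.
- by rewrite -phiZ scalemxAl; apply: wd; rewrite phiZ !psiK.
- exact: QW.
- by rewrite Qid psiK.
Qed.

Definition complemented : Prop := forall W : set S^o, submodule W ->
  exists C : set S^o, [/\ submodule C, forall s, W s -> C s -> s = 0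
    & forall s, exists2 w, W w & C (s - w)].

(** A measure that increases strictly along proper inclusions of submodules: the
    dimension of the preimage in the space of coordinates. *)
Definition sub_rank (W : set S^o) : nat :=
  \max_(k < N.+1 | `[< exists2 A : 'M[F]_N, \rank A = k &
     forall c, (c <= A)%MS -> W (phi c) >]) k.

Lemma sub_rankE W (A : 'M[F]_N) :
  (forall c, (c <= A)%MS <-> W (phi c)) -> sub_rank W = \rank A.
Proof.
move=> AW; apply/eqP; rewrite eqn_leq; apply/andP; split.
  apply/bigmax_leqP => k /asboolP[B <- BW]; apply: mxrankS.
  by apply/row_subP => i; apply/AW/BW; exact: row_sub.
have rA : (\rank A < N.+1)%N by rewrite ltnS rank_leq_col.
apply: (bigmax_sup (Ordinal rA)) => //; apply/asboolP; exists A => // c cA.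
exact/AW.
Qed.

Lemma sub_rank_lt (W W' : set S^o) : submodule W -> submodule W' ->
  W `<=` W' -> W <> W' -> (sub_rank W < sub_rank W')%N.
Proof.
move=> Wm Wm' sW neW; have [A AW] := submodule_mx Wm; have [B BW] := submodule_mx Wm'.
rewrite (sub_rankE AW) (sub_rankE BW).
have sAB : (A <= B)%MS.
  by apply/row_subP => i; apply/BW/sW/AW; exact: row_sub.
rewrite ltn_neqAle mxrankS // andbT (mxrank_leqif_eq sAB).
apply/negP => /andP[_ sBA]; apply: neW; apply/seteqP; split=> // s.
have [c ->] := b_span s; rewrite -/(phi c) => /BW cB.
by apply/AW; apply: submx_trans sBA.
Qed.

Lemma minimal_submodule (W : set S^o) : submodule W -> W != [set 0] ->
  exists2 X, is_simple_submodule X & X `<=` W.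
Proof.
have [n] := ubnP (sub_rank W); elim: n W => // n IHn W rW Wm W0.
have [simpW|] := pselect (is_simple_submodule W); first by exists W.
move=> nsimp; have : exists W', [/\ submodule W', W' `<=` W, W' <> [set 0] & W' <> W].
  apply: contrapT => nW'; apply: nsimp; split=> // W' Wm' sW'.
  have [->|W'0] := pselect (W' = [set 0]); first by left.
  have [->|W'W] := pselect (W' = W); first by right.
  by case: nW'; exists W'.
move=> [W' [Wm' sW' W'0 W'W]].
have [|//||X simX sX] := IHn W'.
- exact: leq_trans (sub_rank_lt Wm' Wm sW' W'W) _.
- exact/eqP.
by exists X => //; exact: subset_trans sW'.
Qed.

Definition semisimple_sub (W : set S^o) : Prop :=
  exists (I : choiceType) (X : I -> set S^o),
  [/\ forall i, is_simple_submodule (X i),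
      forall v, W v <-> exists (s : seq I) (w : I -> S^o),
        (forall i, X i (w i)) /\ v = \sum_(i <- s) w i
    & forall (s : seq I) (w : I -> S^o), uniq s -> (forall i, X i (w i)) ->
        \sum_(i <- s) w i = 0 -> forall i, i \in s -> w i = 0].

(** Split off a minimal submodule [X] of [W] with complement [C], and continue
    with the intersection of [W] and [C]. *)
Lemma complemented_sub (W : set S^o) : complemented -> submodule W -> semisimple_sub W.
Proof.
move=> cpl; have [n] := ubnP (sub_rank W); elim: n W => // n IHn W rW Wm.
case: (Wm) => W0 WD WZ.
have [->|Wn0] := eqVneq W [set 0].
  exists void, (fun=> set0); split; [by case| |by move=> s w _ _ _ []].
  move=> v; split=> [->|[[|[]] [w [_ ->]]]]; last by rewrite big_nil.
  by exists [::], (fun=> 0); split; [case|rewrite big_nil].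
have [X simX sXW] := minimal_submodule Wm Wn0.
case: (simX) => Xm Xn0 _; case: (Xm) => X0 XD XZ.
have [C [Cm XC0 XC]] := cpl X Xm; case: (Cm) => C0 CD CZ.
have Dm : submodule (W `&` C).
  split=> [//|v w [? ?] [? ?]|a v [? ?]]; first by split; [exact: WD|exact: CD].
  by split; [exact: WZ|exact: CZ].
have sDW : W `&` C `<=` W by move=> v [].
have ltD : (sub_rank (W `&` C) < n)%N.
  apply: (leq_trans (sub_rank_lt Dm Wm sDW _)) => // eWC.
  case/eqP: Xn0; apply/seteqP; split=> v /=; last by move->.
  by move=> Xv; apply: XC0 => //; have := sXW v Xv; rewrite -eWC => -[].
have [I [Y [simY spanY indY]]] := IHn _ ltD Dm.
exists (option I), (fun o => if o is Some i then Y i else X); split.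
- by case.
- move=> v; split=> [Wv|[s [w [wX ->]]]].
    have [x Xx Cx] := XC v.
    have /spanY[s [w [wY vE]]] : (W `&` C) (v - x).
      split=> //; apply: WD => //; rewrite -scaleN1r; apply: WZ; exact: sXW.
    exists (None :: map Some s), (fun o => if o is Some i then w i else x).
    split; first by case.
    by rewrite big_cons big_map -vE addrC subrK.
  elim: s => [|o s IHs]; first by rewrite big_nil.
  rewrite big_cons; apply: WD => //; have := wX o; case: o => [i|]; last exact: sXW.
  move=> Yi; apply: sDW; apply/spanY; exists [:: i], (fun j => w (Some j)).
  by split=> [j|]; [exact: (wX (Some j))|rewrite big_seq1].
- move=> s w us wX sw0.
have splitS : \sum_(o <- s) w o =
    \sum_(o <- s | o == None) w o + \sum_(i <- pmap id s) w (Some i).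
  elim: {us sw0} s => [|[i|] s IHs]; first by rewrite !big_nil addr0.
    by rewrite /= !big_cons IHs /= addrCA.
  by rewrite /= !big_cons IHs /= addrA.
set x := \sum_(o <- s | o == None) w o in splitS.
have Xx : X x.
  rewrite /x; apply: (big_ind (fun z => X z)) => // o /eqP->; exact: (wX None).
have Dy : (W `&` C) (\sum_(i <- pmap id s) w (Some i)).
  apply/spanY; exists (pmap id s), (fun i => w (Some i)).
  by split=> // i; exact: (wX (Some i)).
rewrite sw0 in splitS.
have x0 : x = 0.
  apply: XC0 => //; have -> : x = (-1 : S) *: (\sum_(i <- pmap id s) w (Some i) : S^o).
    by rewrite scaleN1r; apply/eqP; rewrite -addr_eq0 -splitS.
  by apply: CZ; case: Dy.
move: splitS; rewrite x0 add0r => /esym y0 [i|] os.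
  apply: (indY (pmap id s) (fun i => w (Some i))) => //.
  - by apply: pmap_uniq us => -[].
  - by move=> j; exact: (wX (Some j)).
  - by rewrite mem_pmap map_id.
by rewrite -x0 /x -big_filter filter_pred1_uniq // big_seq1.
Qed.

Lemma complemented_semisimple : complemented -> semisimple_ring S.
Proof.
move=> cpl; have [] := @complemented_sub setT cpl; first by split.
move=> I [X [simX spanX indX]]; exists I, X; split=> // v.
exact/spanX.
Qed.

(** [q] averages the projection [p] onto [W] and acts on [W] as [z], which [y]
    inverts from the left; so [s - y * q s] is in the kernel of [q], which is a
    complement of [W]. *)
Lemma maschke (c : seq (S * S)) (y : S) :
    (forall p : S -> S, (forall s t, p (s + t) = p s + p t) ->
       (forall a s, p (a *: s) = a *: p s) ->
     forall a s, \sum_(x <- c) a * (x.1 * p (x.2 * s)) =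
                 \sum_(x <- c) x.1 * p (x.2 * (a * s))) ->
    y * \sum_(x <- c) x.1 * x.2 = 1 ->
  complemented.
Proof.
move=> cC yz W Wm; have [p [pD pZ pW pid]] := linear_projection Wm.
case: (Wm) => W0 WD WZ.
pose z := \sum_(x <- c) x.1 * x.2.
pose q s := \sum_(x <- c) x.1 * p (x.2 * s).
have qM a s : q (a * s) = a * q s by rewrite mulr_sumr cC.
have qD s t : q (s + t) = q s + q t.
  by rewrite -big_split; apply: eq_bigr => x _; rewrite mulrDr pD mulrDr.
have qW s : W (q s).
  by apply: (big_ind W) => // x _; apply: WZ.
have qid s : W s -> q s = z * s.
  by move=> Ws; rewrite mulr_suml; apply: eq_bigr => x _; rewrite pid ?mulrA //; exact: WZ.
exists [set s : S^o | q s = 0]; split.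
- split=> [|s t /= s0 t0|a s /= s0].
  + by apply: (addrI (q 0)); rewrite -qD !addr0.
  + by rewrite qD s0 t0 addr0.
  + by rewrite qM s0 mulr0.
- by move=> s Ws /= ; rewrite qid // => zs; rewrite -[s]mul1r -yz -mulrA zs mulr0.
- move=> s; exists (y * q s); first exact: WZ.
  rewrite /= qD -mulN1r !qM (qid _ (qW s)).
  by rewrite (mulrA y) yz mul1r mulN1r subrr.
Qed.

End FiniteAlgebra.

(** * Cramer's rule for the value of the Casimir element *)

Section Coefficients.
Variables (A : comNzRingType) (M : algType A).

Definition is_scalar (x : M) : Prop := exists k : A, x = k%:A.

Lemma is_scalarC k : is_scalar k -> forall x : M, GRing.comm x k.
Proof. by case=> a -> x; rewrite /GRing.comm mulr_algl mulr_algr. Qed.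

Lemma scalar_span_coef (s : seq M) x : scalar_span is_scalar s x ->
  exists c : 'I_(size s) -> A, x = \sum_i c i *: s`_i.
Proof.
elim=> {x} [x xs||x y _ [c ->] _ [d ->]|x _ [c ->]|k x [a ->] _ [c ->]].
- move: xs; rewrite -index_mem => xs; exists (fun i => (i == Ordinal xs)%:R).
  rewrite (bigD1 (Ordinal xs)) //= eqxx scale1r nth_index -?index_mem //.
  by rewrite big1 ?addr0 // => i /negPf->; rewrite scale0r.
- by exists (fun=> 0); rewrite big1 // => i _; rewrite scale0r.
- exists (fun i => c i + d i); rewrite -big_split.
  by apply: eq_bigr => i _; rewrite scalerDl.
- by exists (fun i => - c i); rewrite -sumrN; apply: eq_bigr => i _; rewrite scaleNr.
- exists (fun i => a * c i); rewrite mulr_algl scaler_sumr.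
  by apply: eq_bigr => i _; rewrite scalerA.
Qed.

(** Let [Z] be the matrix under the determinant, where [Y] expresses
    multiplication by [y] on the family [b]; then [z * b i] is the combination of
    the [b j] with coefficients [Z i j]. Multiplying by the adjugate of [Z]
    shows that [\det Z] times each [b i], hence [\det Z] times 1, is a multiple
    of the central element [z]. *)
Lemma det_multiple (n N : nat) (u : A) (b : 'I_n -> M) (z y : M) :
    (forall x, exists c : 'I_n -> A, x = \sum_i c i *: b i) ->
    z = N%:R + (u - 1)%:A * y -> (forall x, GRing.comm x z) ->
  exists (Y : 'M[A]_n) (x : M), x * z = (\det (N%:R%:M + (u - 1) *: Y))%:A.
Proof.
move=> bspan zE zC.
have [Y YE] : exists Y : 'M[A]_n, forall i, y * b i = \sum_j Y i j *: b j.
  have [c cE] := choice (fun i => bspan (y * b i)).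
  by exists (\matrix_(i, j) c i j) => i; rewrite cE; apply: eq_bigr => j _; rewrite mxE.
exists Y; set Z := _ + _.
have ZE i : z * b i = \sum_j Z i j *: b j.
  rewrite zE mulrDl mulr_natl -mulrA mulr_algl YE scaler_sumr.
  under [RHS]eq_bigr do rewrite !mxE scalerDl.
  rewrite big_split /= [X in _ = X + _](bigD1 i) //= eqxx mulr1n.
  rewrite [X in _ = _ + X + _]big1 ?addr0.
    by rewrite scaler_nat; congr (_ + _); apply: eq_bigr => j _; exact: scalerA.
  by move=> j ji; rewrite eq_sym (negPf ji) mulr0n scale0r.
have detE i : (\det Z) *: b i = (\sum_j (\adj Z) i j *: b j) * z.
  transitivity (\sum_k ((\adj Z) *m Z) i k *: b k).
    rewrite mul_adj_mx (bigD1 i) //= mxE eqxx big1 ?addr0 // => k ki.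
    by rewrite mxE eq_sym (negPf ki) scale0r.
  under eq_bigr do rewrite mxE scaler_suml.
  rewrite exchange_big mulr_suml; apply: eq_bigr => j _ /=.
  rewrite -scalerAl (zC (b j)) ZE scaler_sumr; apply: eq_bigr => k _.
  by rewrite scalerA.
have [c c1] := bspan 1.
exists (\sum_i c i *: \sum_j (\adj Z) i j *: b j).
rewrite mulr_suml [in RHS]c1 scaler_sumr; apply: eq_bigr => i _.
by rewrite -scalerAl -detE !scalerA mulrC.
Qed.

End Coefficients.

(** * The algebra over the Laurent polynomials *)

Section Specialization.
Variables (F : fieldType) (n : nat).
Local Notation A := (laurent F).
Local Notation M := (bt_alg F n).
Local Notation m := n.-1.

Lemma laurent_uinv_subproof :
  (FracField.tofrac ('X : {poly F}))^-1 \in @is_laurent F.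
Proof.
apply/asboolP; exists 1%N, 1.
by rewrite expr1 mulVf ?tofrac1 // tofrac_eq0 polyX_eq0.
Qed.

Definition laurent_uinv : A := Laurent laurent_uinv_subproof.

Lemma laurent_uK : laurent_u F * laurent_uinv = 1.
Proof.
apply: val_inj; rewrite rmorphM rmorph1 /=.
by rewrite mulfV // tofrac_eq0 polyX_eq0.
Qed.

(** Indexed by [nat], to allow arithmetic on indices; the value 1 is taken beyond
    the last generator. *)
Definition bt_T (i : nat) : M :=
  if insub i is Some o then pres_pi _ (TGen (GT o)) else 1.
Definition bt_E (i : nat) : M :=
  if insub i is Some o then pres_pi _ (TGen (GE o)) else 1.

Lemma pres_pi_scalar (k : A) : pres_pi (@bt_rel F n) (TCst k) = k%:A :> M.
Proof.
by rewrite -[LHS]mulr1 -pres_scaleM.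
Qed.

Lemma bt_alg_rel : braids_ties (M := M) (laurent_u F)%:A m bt_T bt_E.
Proof.
have TE (i : 'I_m) : bt_T i = pres_pi _ (TGen (GT i)).
  by rewrite /bt_T insubT //= => lt; congr (pres_pi _ (TGen (GT _))); exact: val_inj.
have EE (i : 'I_m) : bt_E i = pres_pi _ (TGen (GE i)).
  by rewrite /bt_E insubT //= => lt; congr (pres_pi _ (TGen (GE _))); exact: val_inj.
have dist1 (i j : nat) : adjacent i j -> `|i%:Z - j%:Z|%N = 1%N by rewrite /adjacent; lia.
have dist2 (i j : nat) : apart i j -> (`|i%:Z - j%:Z| > 1)%N by rewrite /apart; lia.
have ord i (im : (i < m)%N) : i = Ordinal im by [].
have R s t : bt_rel s t -> pres_pi (@bt_rel F n) s = pres_pi (@bt_rel F n) t :> M.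
  by move=> h; apply/pres_piP/pres_rel.
split.
- move=> i j im jm /dist2 d; rewrite (ord i im) (ord j jm) !TE.
  by have := R _ _ (@bt_A1 F n (Ordinal im) (Ordinal jm) d); rewrite !pres_piM.
- move=> i j im jm; rewrite (ord i im) (ord j jm) !EE.
  by have := R _ _ (@bt_A2 F n (Ordinal im) (Ordinal jm)); rewrite !pres_piM.
- move=> i im; rewrite (ord i im) !EE.
  by have := R _ _ (@bt_A3 F n (Ordinal im)); rewrite !pres_piM.
- move=> i im; rewrite (ord i im) EE TE.
  by have := R _ _ (@bt_A4 F n (Ordinal im)); rewrite !pres_piM.
- move=> i j im jm /dist2 d; rewrite (ord i im) (ord j jm) EE TE.
  by have := R _ _ (@bt_A5 F n (Ordinal im) (Ordinal jm) d); rewrite !pres_piM.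
- move=> i j im jm /dist1 d; rewrite (ord i im) (ord j jm) !TE.
  by have := R _ _ (@bt_A6 F n (Ordinal im) (Ordinal jm) d); rewrite !pres_piM.
- move=> i j im jm /dist1 d; rewrite (ord i im) (ord j jm) !EE !TE.
  by have := R _ _ (@bt_A7 F n (Ordinal im) (Ordinal jm) d); rewrite !pres_piM.
- move=> i j im jm /dist1 d; rewrite (ord i im) (ord j jm) !EE TE.
  by have := R _ _ (@bt_A8l F n (Ordinal im) (Ordinal jm) d); rewrite !pres_piM.
- move=> i j im jm /dist1 d; rewrite (ord i im) (ord j jm) !EE TE.
  by have := R _ _ (@bt_A8r F n (Ordinal im) (Ordinal jm) d); rewrite !pres_piM.
- move=> i im; rewrite (ord i im) EE TE.
  have -> : (laurent_u F)%:A - 1 = pres_pi (@bt_rel F n) (TCst (laurent_u F - 1)) :> M.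
    by rewrite pres_pi_scalar scalerBl scale1r.
  have := R _ _ (@bt_A9 F n (Ordinal im)).
  by rewrite !(pres_piM, pres_piD, pres_piN) -mulrA.
Qed.

Lemma bt_alg_gen (P : M -> Prop) :
  (forall i, (i < m)%N -> P (bt_T i)) -> (forall i, (i < m)%N -> P (bt_E i)) ->
  (forall k, is_scalar k -> P k) -> (forall x y, P x -> P y -> P (x + y)) ->
  (forall x y, P x -> P y -> P (x * y)) -> forall x, P x.
Proof.
move=> PT PE PK PD PM; apply: pres_ind; elim=> [[i|i]|k|s Ps t Pt|s Ps|s Ps t Pt].
- have := PT i (ltn_ord i); rewrite /bt_T insubT //= => ?.
  by congr (P (pres_pi _ (TGen (GT _)))); exact: val_inj.
- have := PE i (ltn_ord i); rewrite /bt_E insubT //= => ?.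
  by congr (P (pres_pi _ (TGen (GE _)))); exact: val_inj.
- by rewrite pres_pi_scalar; apply: PK; exists k.
- by rewrite pres_piD; apply: PD.
- rewrite pres_piN -mulN1r; apply: PM => //; apply: PK; exists (-1).
  by rewrite scaleN1r.
- by rewrite pres_piM; apply: PM.
Qed.

Lemma bt_generic_casimir : exists (c : seq (M * M)) (N : nat) (b : 'I_N -> M)
    (Y : 'M[A]_N) (y : M),
  [/\ forall a, casimir (@is_scalar A M) c a,
      forall x, exists d : 'I_N -> A, x = \sum_i d i *: b i
    & y * \sum_(p <- c) p.1 * p.2 =
      (\det ((m.+1)`!%:R%:M + (laurent_u F - 1) *: Y))%:A].
Proof.
pose u : M := (laurent_u F)%:A; pose v : M := laurent_uinv%:A.
have uv : u * v = 1 by rewrite /u /v mulr_algl scalerA laurent_uK scale1r.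
have Ku : is_scalar u by exists (laurent_u F).
have Kv : is_scalar v by exists laurent_uinv.
have KC := @is_scalarC A M; have rel := bt_alg_rel.
pose c := bt_casimir u v m bt_T bt_E m.
pose W := bt_words u v m bt_T bt_E m.
have Wspan x : exists d : 'I_(size W) -> A, x = \sum_i d i *: W`_i.
  exact/scalar_span_coef/(scalar_span_all KC Ku Kv uv rel bt_alg_gen).
have [y yE] := casimir_value_near KC Ku Kv uv rel (leqnn m).
have zC := casimir_value_central KC Ku Kv uv rel bt_alg_gen.
have zE : casimir_value c = (m.+1)`!%:R + (laurent_u F - 1)%:A * y.
  by rewrite yE scalerBl scale1r.
have [Y [x xz]] := det_multiple Wspan zE zC.
exists c, (size W), (fun i => W`_i), Y, x; split=> [a||]; [|exact: Wspan|].
  exact: (bt_casimirP KC Ku Kv uv rel bt_alg_gen).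
exact: xz.
Qed.

End Specialization.

(** * Specialization of the parameter *)

Section Fibre.
Variables (F : fieldType) (n : nat) (x : F) (x0 : x != 0).
Local Notation A := (laurent F).
Local Notation M := (bt_alg F n).
Local Notation S := (bt_spec n x0).
Local Notation ev := (laurent_eval x0).

Definition spec (a : M) : S := tens_pi (laurent_eval x0) [:: (a, 1)].

Lemma specD a b : spec (a + b) = spec a + spec b.
Proof. by rewrite /spec -[RHS]tens_piD; apply/tens_piP/tens_Dl. Qed.

Lemma specM a b : spec (a * b) = spec a * spec b.
Proof. by rewrite /spec [RHS]tens_mulE tsum_mul1l /= mulr1. Qed.

Lemma specZ k a : spec (k *: a) = ev k *: spec a.
Proof.
rewrite /spec [RHS]tens_scaleE /=; apply/tens_piP; rewrite mulr1 -[X in [:: (a, X)]]mulr1.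
exact: tens_bal.
Qed.

Lemma spec1 : spec 1 = 1. Proof. by []. Qed.

Lemma spec_span (P : S -> Prop) : P 0 -> (forall s t, P s -> P t -> P (s + t)) ->
  (forall c a, P (c *: spec a)) -> forall s, P s.
Proof.
move=> P0 PD Pspec; apply: tens_ind; elim=> [|[a c] s IHs]; first exact: P0.
rewrite -cat1s tens_piD; apply: PD => //.
have := Pspec c a; rewrite /spec [_ *: _]tens_scaleE /= mulr1; exact.
Qed.

Lemma spec_sum (I : Type) (r : seq I) (f : I -> M) :
  spec (\sum_(i <- r) f i) = \sum_(i <- r) spec (f i).
Proof.
elim: r => [|i r IHr]; last by rewrite !big_cons specD IHr.
by rewrite !big_nil; apply: (addrI (spec 0)); rewrite -specD !addr0.
Qed.

(** The Casimir element and the divisor [h] of its value specialize: the test map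
    [spec z * p (spec t * s)] is balanced over the Laurent polynomials because
    they act on the fibre through their values at [x]. *)
Lemma fibre_semisimple (c : seq (M * M)) (N : nat) (b : 'I_N -> M) (h : A) (y : M) :
    (forall a, casimir (@is_scalar A M) c a) ->
    (forall z, exists d : 'I_N -> A, z = \sum_i d i *: b i) ->
    y * \sum_(p <- c) p.1 * p.2 = h%:A -> ev h != 0 ->
  semisimple_ring S.
Proof.
move=> cC bspan yz h0.
have sspan (s : S) : exists d : 'rV[F]_N, s = \sum_i d 0 i *: spec (b i).
  move: s; apply: spec_span => [|s t [d ->] [e ->]|k a].
  - by exists 0; rewrite big1 // => i _; rewrite mxE scale0r.
  - by exists (d + e); rewrite -big_split; apply: eq_bigr => i _; rewrite mxE scalerDl.
  - have [d ->] := bspan a; exists (\row_i (k * ev (d i))).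
    rewrite spec_sum scaler_sumr; apply: eq_bigr => i _.
    by rewrite specZ mxE scalerA.
apply: (complemented_semisimple sspan).
apply: (maschke sspan (c := [seq (spec p.1, spec p.2) | p <- c])
  (y := (ev h)^-1 *: spec y)).
  move=> p pD pZ a s; rewrite !big_map /=; move: a.
  have p0 : p 0 = 0 by apply: (addrI (p 0)); rewrite -pD !addr0.
  apply: spec_span => [|a a' aE a'E|k a].
  - by rewrite !big1 // => q _; rewrite ?mul0r ?mulr0 ?p0 ?mulr0.
  - under eq_bigr do rewrite mulrDl.
    under [RHS]eq_bigr do rewrite mulrDl mulrDr pD mulrDr.
    by rewrite !big_split aE a'E.
  - under eq_bigr do rewrite -scalerAl mulrA -specM.
    under [RHS]eq_bigr do rewrite -scalerAl -scalerAr mulrA -specM pZ -scalerAr.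
    rewrite -!scaler_sumr; congr (_ *: _).
    apply: (cC a _ (fun z t => spec z * p (spec t * s))).
    split=> [z z' t|z t t'|_ [l ->] z t].
    + by rewrite specD mulrDl.
    + by rewrite specD mulrDl pD mulrDr.
    + by rewrite mulr_algr mulr_algl !specZ -!scalerAl pZ -scalerAr.
rewrite big_map; under eq_bigr do rewrite /= -specM.
by rewrite -spec_sum -scalerAl -specM yz specZ spec1 scalerA mulVf // scale1r.
Qed.

End Fibre.

Lemma laurent_eval_u1 (F : fieldType) (x0 : (1 : F) != 0) :
  laurent_eval x0 (laurent_u F - 1) = 0.
Proof. by rewrite rmorphB rmorph1 /= laurent_eval_poly hornerX subrr. Qed.

Lemma generically_semisimple (F : numFieldType) (n : nat) :
  exists U : set F, [/\ zariski_open U, U !=set0, ~ U 0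
    & forall (x : F) (x0 : x != 0), U x -> semisimple_ring (bt_spec n x0)]%classic.
Proof.
have [c [N [b [Y [y [cC bspan yz]]]]]] := bt_generic_casimir F n.
set h := \det _ in yz.
have [[k p] /= hp] := laurent_repP h.
have n1 : (1 : F) != 0 := oner_neq0 F.
have h1 : laurent_eval n1 h != 0.
  rewrite /h -det_map_mx map_mxD map_mxZ /= laurent_eval_u1 scale0r addr0.
  by rewrite map_scalar_mx det_scalar rmorph_nat expf_neq0 // pnatr_eq0 -lt0n fact_gt0.
exists [set x | ('X * p).[x] != 0]%classic; split.
- exists [set 'X * p]%classic; apply/seteqP; split=> x /=.
    by move/negP/negPn/eqP => px q ->.
  by move=> /(_ _ erefl) ->; rewrite eqxx.
- exists 1; rewrite /= hornerM hornerX mul1r.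
  by have := h1; rewrite (laurent_evalE _ hp) mulf_eq0 negb_or => /andP[].
- by rewrite /= hornerM hornerX mul0r eqxx.
- move=> x x0 /=; rewrite hornerM mulf_eq0 negb_or => /andP[_ px].
  apply: (fibre_semisimple cC bspan yz).
  by rewrite (laurent_evalE _ hp) mulf_neq0 // invr_neq0 // expf_neq0.
Qed.

Local Open Scope classical_set_scope.

Theorem theorem5p2 (R : realType) (n : nat) (hn : (1 <= n)%N) :
  exists U : set R[i],
    [/\ zariski_open U, U !=set0, ~ U 0
      & forall (x : R[i]) (x0 : x != 0), U x -> semisimple_ring (bt_spec n x0)].
Proof. exact: generically_semisimple. Qed.
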